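(* Let $G$ be an Artin group with its standard presentation $\mathcal{P}$, and let $\mathbf{a}$, $\mathbf{a}'$ be generator $G$-systems having the same length. Then: (1) $\mathbf{a} \sim_{H} \mathbf{a}'$ if and only if $C(\mathbf{a}) = C(\mathbf{a}')$. (2) If $G$ is a right-angled Artin group, then $\mathbf{a} \sim_{HC}\mathbf{a}'$ if and only if $C(\mathbf{a})$ and $C(\mathbf{a}')$ are conjugate in $G$.
   Context: Let $M=(m_{ij})_{1\le i,j\le n}$ be a Coxeter matrix: a symmetric matrix with $m_{ii}=1$ and $m_{ij}\in\{2,3,\dots,\infty\}$ for $i\neq j$. The Artin group corresponding to $M$ is the group $G$ given by the standard presentation $\mathcal{P}$ with generating set $\mathcal{S}=\{a_1,\dots,a_n\}$ and, for each pair $i\ne j$ with $m_{ij}\neq\infty$, the relation $a_ia_ja_i\cdots = a_ja_ia_j\cdots$, where both sides are alternating words of length $m_{ij}$. It is right-angled if all $m_{ij}$ with $i\ne j$ are $2$ or $\infty$. A $G$-system of length $m$ is an element of $G^m$; a generator $G$-system of length $m$ is an element of $\mathcal{S}^m$, i.e. a $G$-system all of whose entries are standard generators. The braid group $B_m$, with standard generators $\sigma_1,\dots,\sigma_{m-1}$, acts on $G^m$ from the right by $(g_1,\dots,g_m)\cdot\sigma_i=(g_1,\dots,g_{i-1},g_{i+1},g_{i+1}^{-1}g_ig_{i+1},g_{i+2},\dots,g_m)$. The group $G$ acts on $G^m$ from the right by $(g_1,\dots,g_m)\cdot g=(g^{-1}g_1g,\dots,g^{-1}g_mg)$; the two actions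 commute, giving an action of $G\times B_m$. Two $G$-systems of length $m$ are Hurwitz equivalent ($\sim_H$) if they are in the same $B_m$-orbit, and Hurwitz-conjugation equivalent, or HC-equivalent ($\sim_{HC}$), if they are in the same $(G\times B_m)$-orbit. The Coxeter element of $\mathbf{g}=(g_1,\dots,g_m)$ is $C(\mathbf{g})=g_1g_2\cdots g_m\in G$. *)

(* Defs.v *)
(* boolp is used only to turn equality of words modulo a presentation, which
   may be undecidable, into a boolean relation. *)
From HB Require Import structures.
From mathcomp Require Import all_boot boolp.
From mathcomp Require Import zify.

Set Implicit Arguments.
Unset Strict Implicit.
Unset Printing Implicit Defensive.

Local Open Scope group_scope.
Local Open Scope quotient_scope.

(* The letter (x, true) stands for the generator x, (x, false) for x^-1. *)
Definition letters (I : choiceType) : choiceType := seq (I * bool).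

Definition letters_inv (I : choiceType) (w : letters I) : letters I :=
  rev [seq (l.1, ~~ l.2) | l <- w].

Inductive presented_eq (I : choiceType) (R : letters I -> letters I -> Prop) :
    letters I -> letters I -> Prop :=
| presented_eq_rel u v : R u v -> presented_eq R u v
| presented_eq_cancel x b : presented_eq R [:: (x, b); (x, ~~ b)] [::]
| presented_eq_cat u u' v v' :
    presented_eq R u u' -> presented_eq R v v' ->
    presented_eq R (u ++ v) (u' ++ v')
| presented_eq_refl u : presented_eq R u u
| presented_eq_sym u v : presented_eq R u v -> presented_eq R v u
| presented_eq_trans u v w :
    presented_eq R u v -> presented_eq R v w -> presented_eq R u w.

Definition presented_eqb (I : choiceType) (R : letters I -> letters I -> Prop) :
  rel (letters I) := fun u v => `[< presented_eq R u v >].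

Lemma presented_eqb_equiv (I : choiceType) (R : letters I -> letters I -> Prop) :
  equiv_class_of (presented_eqb R).
Proof.
split.
- by move=> u; apply/asboolP; apply: presented_eq_refl.
- by move=> u v; apply/asboolP/asboolP; apply: presented_eq_sym.
- move=> v u w /asboolP uv /asboolP vw; apply/asboolP.
  exact: presented_eq_trans uv vw.
Qed.

Canonical presented_equiv (I : choiceType) (R : letters I -> letters I -> Prop) :=
  EquivRelPack (presented_eqb_equiv R).

(* The group < I | u = v for all (u, v) such that R u v >. *)
Definition presented_group (I : choiceType)
  (R : letters I -> letters I -> Prop) := {eq_quot (presented_equiv R)}.

HB.instance Definition _ (I : choiceType) (R : letters I -> letters I -> Prop) :=
  Choice.on (presented_group R).
HB.instance Definition _ (I : choiceType) (R : letters I -> letters I -> Prop) :=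
  EqQuotient.on (presented_group R).

Definition presented_class (I : choiceType) (R : letters I -> letters I -> Prop)
  (w : letters I) : presented_group R := \pi_(presented_group R) w.

Definition presented_mul (I : choiceType) (R : letters I -> letters I -> Prop)
  (x y : presented_group R) : presented_group R :=
  presented_class R (repr x ++ repr y).

Definition presented_inv (I : choiceType) (R : letters I -> letters I -> Prop)
  (x : presented_group R) : presented_group R :=
  presented_class R (letters_inv (repr x)).

Lemma presented_classP (I : choiceType) (R : letters I -> letters I -> Prop)
    (u v : letters I) :
  presented_class R u = presented_class R v <-> presented_eq R u v.
Proof.
split=> [/eqP|uv].
- by rewrite /presented_class eqquotE => /asboolP.
- by apply/eqP; rewrite /presented_class eqquotE; apply/asboolP.
Qed.

Lemma presented_reprK (I : choiceType) (R : letters I -> letters I -> Prop)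
  (x : presented_group R) : presented_class R (repr x) = x.
Proof. exact: reprK. Qed.

Lemma presented_repr_class (I : choiceType)
    (R : letters I -> letters I -> Prop) (w : letters I) :
  presented_eq R (repr (presented_class R w)) w.
Proof. by apply/presented_classP; rewrite presented_reprK. Qed.

Lemma letters_inv_cat (I : choiceType) (u v : letters I) :
  letters_inv (u ++ v) = letters_inv v ++ letters_inv u.
Proof. by rewrite /letters_inv map_cat rev_cat. Qed.

Lemma letters_invK (I : choiceType) : involutive (@letters_inv I).
Proof.
move=> w; rewrite /letters_inv map_rev revK -map_comp.
by rewrite -[RHS]map_id; apply: eq_map => -[x b] /=; rewrite negbK.
Qed.

Lemma presented_eq_invr (I : choiceType) (R : letters I -> letters I -> Prop)
  (w : letters I) : presented_eq R (w ++ letters_inv w) [::].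
Proof.
elim/last_ind: w => [|w [x b] IHw]; first exact: presented_eq_refl.
rewrite -cats1 letters_inv_cat -catA.
apply: presented_eq_trans IHw.
apply: presented_eq_cat; first exact: presented_eq_refl.
rewrite -[X in presented_eq _ _ X]cat0s catA.
apply: presented_eq_cat; last exact: presented_eq_refl.
exact: presented_eq_cancel.
Qed.

Lemma presented_eq_invl (I : choiceType) (R : letters I -> letters I -> Prop)
  (w : letters I) : presented_eq R (letters_inv w ++ w) [::].
Proof. by have := presented_eq_invr R (letters_inv w); rewrite letters_invK. Qed.

Lemma presented_mul_class (I : choiceType)
    (R : letters I -> letters I -> Prop) (u v : letters I) :
  presented_mul (presented_class R u) (presented_class R v)
  = presented_class R (u ++ v).
Proof. by apply/presented_classP/presented_eq_cat; apply: presented_repr_class. Qed.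

Lemma presented_mulA (I : choiceType) (R : letters I -> letters I -> Prop) :
  associative (@presented_mul I R).
Proof.
move=> x y z; rewrite -[x]presented_reprK -[y]presented_reprK.
by rewrite -[z]presented_reprK !presented_mul_class catA.
Qed.

Lemma presented_mul1 (I : choiceType) (R : letters I -> letters I -> Prop) :
  left_id (presented_class R [::]) (@presented_mul I R).
Proof. by move=> x; rewrite -[x]presented_reprK presented_mul_class. Qed.

Lemma presented_mulr1 (I : choiceType) (R : letters I -> letters I -> Prop) :
  right_id (presented_class R [::]) (@presented_mul I R).
Proof. by move=> x; rewrite -[x]presented_reprK presented_mul_class cats0. Qed.

Lemma presented_mulV (I : choiceType) (R : letters I -> letters I -> Prop) :
  left_inverse (presented_class R [::]) (@presented_inv I R) (@presented_mul I R).
Proof.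
move=> x; rewrite -[in X in presented_mul _ X](presented_reprK x).
by rewrite presented_mul_class; apply/presented_classP/presented_eq_invl.
Qed.

Lemma presented_mulrV (I : choiceType) (R : letters I -> letters I -> Prop) :
  right_inverse (presented_class R [::]) (@presented_inv I R) (@presented_mul I R).
Proof.
move=> x; rewrite -[in X in presented_mul X _](presented_reprK x).
by rewrite presented_mul_class; apply/presented_classP/presented_eq_invr.
Qed.

HB.instance Definition _ (I : choiceType) (R : letters I -> letters I -> Prop) :=
  isGroup.Build (presented_group R) (@presented_mulA I R) (@presented_mul1 I R)
    (@presented_mulr1 I R) (@presented_mulV I R) (@presented_mulrV I R).

(* None stands for the entry oo. *)
Record coxeter_matrix (n : nat) := CoxeterMatrix {
  cox_entry :> 'I_n -> 'I_n -> option nat;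
  cox_sym : forall i j, cox_entry i j = cox_entry j i;
  cox_diag : forall i, cox_entry i i = Some 1%N;
  cox_off_diag : forall i j k, i != j -> cox_entry i j = Some k -> (2 <= k)%N
}.

Fixpoint alternating (I : choiceType) (x y : I) (k : nat) : letters I :=
  if k is k'.+1 then (x, true) :: alternating y x k' else [::].

Inductive artin_rel (n : nat) (M : coxeter_matrix n) :
    letters 'I_n -> letters 'I_n -> Prop :=
| ArtinRel i j k : i != j -> M i j = Some k ->
    artin_rel M (alternating i j k) (alternating j i k).

Definition artin_group (n : nat) (M : coxeter_matrix n) : groupType :=
  presented_group (artin_rel M).

Definition artin_gen (n : nat) (M : coxeter_matrix n) (i : 'I_n) :
  artin_group M := presented_class (artin_rel M) [:: (i, true)].

Definition right_angled (n : nat) (M : coxeter_matrix n) : Prop :=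
  forall i j, i != j -> M i j = Some 2%N \/ M i j = None.

Definition braid_entry (k : nat) (i j : 'I_k) : option nat :=
  Some (if i == j then 1%N
        else if (i.+1 == j :> nat) || (j.+1 == i :> nat) then 3%N else 2%N).

Lemma braid_entry_sym (k : nat) (i j : 'I_k) : braid_entry i j = braid_entry j i.
Proof. by rewrite /braid_entry eq_sym orbC. Qed.

Lemma braid_entry_diag (k : nat) (i : 'I_k) : braid_entry i i = Some 1%N.
Proof. by rewrite /braid_entry eqxx. Qed.

Lemma braid_entry_off_diag (k : nat) (i j : 'I_k) (l : nat) :
  i != j -> braid_entry i j = Some l -> (2 <= l)%N.
Proof. by rewrite /braid_entry => /negPf-> [<-]; case: ifP. Qed.

Definition braid_matrix (k : nat) : coxeter_matrix k :=
  CoxeterMatrix (@braid_entry_sym k) (@braid_entry_diag k)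
    (@braid_entry_off_diag k).

(* Artin's presentation of the braid group on m strands. *)
Definition braid_group (m : nat) : groupType := artin_group (braid_matrix m.-1).

(* With i : 'I_m.-1 counted from 0, this generator is usually written
   sigma_(i+1); it acts on the entries of (0-based) index i and i+1. *)
Definition braid_sigma (m : nat) (i : 'I_m.-1) : braid_group m :=
  artin_gen (braid_matrix m.-1) i.

Definition right_action (B : groupType) (X : Type) (act : X -> B -> X) : Prop :=
  (forall x, act x 1 = x) /\ (forall x b c, act x (b * c) = act (act x b) c).

Definition same_orbit (B : groupType) (X : Type) (act : X -> B -> X)
  (x y : X) : Prop := exists b : B, act x b = y.

Definition hurwitz_move (G : groupType) (m : nat) (g : m.-tuple G)
  (i : 'I_m.-1) : m.-tuple G :=
  [tuple if j == i :> nat then g`_i.+1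
         else if j == i.+1 :> nat then g`_i ^ g`_i.+1
         else g`_j | j < m].

Definition hurwitz_move_inv (G : groupType) (m : nat) (g : m.-tuple G)
  (i : 'I_m.-1) : m.-tuple G :=
  [tuple if j == i :> nat then g`_i.+1 ^ (g`_i)^-1
         else if j == i.+1 :> nat then g`_i
         else g`_j | j < m].

Definition hurwitz_letters (G : groupType) (m : nat) (g : m.-tuple G)
  (w : letters 'I_m.-1) : m.-tuple G :=
  foldl (fun h l => if l.2 then hurwitz_move h l.1 else hurwitz_move_inv h l.1)
    g w.

(* Defined through representatives; hurwitz_act_class, hurwitz_act_sigma and
   hurwitz_act_action below show that it is the right action of the braid group
   in which sigma_i acts by hurwitz_move. *)
Definition hurwitz_act (G : groupType) (m : nat) (g : m.-tuple G)
  (b : braid_group m) : m.-tuple G :=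
  hurwitz_letters g (repr (b : presented_group (artin_rel (braid_matrix m.-1)))).

Lemma hurwitz_move_nth (G : groupType) (m : nat) (g : m.-tuple G)
    (i : 'I_m.-1) (j : nat) :
  (hurwitz_move g i)`_j = if j == i then g`_i.+1
    else if j == i.+1 then g`_i ^ g`_i.+1 else g`_j.
Proof.
have [jm|mj] := ltnP j m.
  by rewrite -(tnth_nth 1 _ (Ordinal jm)) tnth_mktuple.
have im := ltn_ord i.
have -> : (j == i) = false by lia.
have -> : (j == i.+1) = false by lia.
by rewrite !nth_default ?size_tuple.
Qed.

Lemma hurwitz_move_inv_nth (G : groupType) (m : nat) (g : m.-tuple G)
    (i : 'I_m.-1) (j : nat) :
  (hurwitz_move_inv g i)`_j = if j == i then g`_i.+1 ^ (g`_i)^-1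
    else if j == i.+1 then g`_i else g`_j.
Proof.
have [jm|mj] := ltnP j m.
  by rewrite -(tnth_nth 1 _ (Ordinal jm)) tnth_mktuple.
have im := ltn_ord i.
have -> : (j == i) = false by lia.
have -> : (j == i.+1) = false by lia.
by rewrite !nth_default ?size_tuple.
Qed.

Lemma tuple_nth_ext (G : groupType) (m : nat) (g h : m.-tuple G) :
  (forall j, g`_j = h`_j) -> g = h.
Proof. by move=> gh; apply: eq_from_tnth => j; rewrite !(tnth_nth 1). Qed.

Lemma hurwitz_moveK (G : groupType) (m : nat) (g : m.-tuple G) (i : 'I_m.-1) :
  hurwitz_move_inv (hurwitz_move g i) i = g.
Proof.
apply: tuple_nth_ext => j.
rewrite hurwitz_move_inv_nth !hurwitz_move_nth !eqxx.
rewrite (_ : (i.+1 == i :> nat) = false); last by lia.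
case: (eqVneq j i) => [->|ji]; first by rewrite conjgK.
by case: (eqVneq j i.+1) => [->|].
Qed.

Lemma hurwitz_move_invK (G : groupType) (m : nat) (g : m.-tuple G)
  (i : 'I_m.-1) : hurwitz_move (hurwitz_move_inv g i) i = g.
Proof.
apply: tuple_nth_ext => j.
rewrite hurwitz_move_nth !hurwitz_move_inv_nth !eqxx.
rewrite (_ : (i.+1 == i :> nat) = false); last by lia.
case: (eqVneq j i) => [->|ji] //.
by case: (eqVneq j i.+1) => [->|] //; rewrite conjgKV.
Qed.

Lemma hurwitz_move_comm (G : groupType) (m : nat) (g : m.-tuple G)
    (i k : 'I_m.-1) : i.+1 < k ->
  hurwitz_move (hurwitz_move g i) k = hurwitz_move (hurwitz_move g k) i.
Proof.
move=> ik; apply: tuple_nth_ext => j; rewrite !hurwitz_move_nth.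
by do ![case: eqP => ?]; try lia.
Qed.

Lemma hurwitz_move_braid (G : groupType) (m : nat) (g : m.-tuple G)
    (i k : 'I_m.-1) : i.+1 = k ->
  hurwitz_move (hurwitz_move (hurwitz_move g i) k) i
  = hurwitz_move (hurwitz_move (hurwitz_move g k) i) k.
Proof.
move=> ik; apply: tuple_nth_ext => j; rewrite !hurwitz_move_nth -!ik.
move: (nat_of_ord i) => {ik k} i; rewrite !eqxx.
have E1 : (i.+1 == i) = false by lia.
have E2 : (i.+2 == i) = false by lia.
have E3 : (i.+2 == i.+1) = false by lia.
have E4 : (i == i.+1) = false by lia.
have E5 : (i == i.+2) = false by lia.
have E6 : (i.+1 == i.+2) = false by lia.
rewrite ?(E1, E2, E3, E4, E5, E6).
case: (eqVneq j i) => [->|ji]; first by rewrite ?(E1, E2, E3, E4, E5, E6).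
case: (eqVneq j i.+1) => // _; case: (eqVneq j i.+2) => // _.
by rewrite -!conjgM -conjgC.
Qed.

Lemma hurwitz_letters_cat (G : groupType) (m : nat) (g : m.-tuple G)
    (u v : letters 'I_m.-1) :
  hurwitz_letters g (u ++ v) = hurwitz_letters (hurwitz_letters g u) v.
Proof. exact: foldl_cat. Qed.

Lemma hurwitz_letters_eq (G : groupType) (m : nat) (u v : letters 'I_m.-1) :
  presented_eq (artin_rel (braid_matrix m.-1)) u v ->
  forall g : m.-tuple G, hurwitz_letters g u = hurwitz_letters g v.
Proof.
elim=> {u v}
  [_ _ [i j k nij [<-]]|x b|u u' v v' _ IHu _ IHv|u|u v _ IH|u v w _ IHu _ IHv] g //.
- rewrite (negPf nij); case: ifP => ij /=.
    case/orP: ij => /eqP ij; first exact: hurwitz_move_braid.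
    by rewrite (hurwitz_move_braid _ ij).
  have [lij|lji] := ltnP i j.
    by apply: hurwitz_move_comm; lia.
  by apply/esym/hurwitz_move_comm; move: nij; rewrite -val_eqE /=; lia.
- by case: b => /=; [exact: hurwitz_moveK | exact: hurwitz_move_invK].
- by rewrite !hurwitz_letters_cat IHu IHv.
- by rewrite IHu IHv.
Qed.

Lemma hurwitz_act_class (G : groupType) (m : nat) (g : m.-tuple G)
    (w : letters 'I_m.-1) :
  hurwitz_act g (presented_class (artin_rel (braid_matrix m.-1)) w)
  = hurwitz_letters g w.
Proof. exact/hurwitz_letters_eq/presented_repr_class. Qed.

Lemma hurwitz_act_sigma (G : groupType) (m : nat) (g : m.-tuple G)
    (i : 'I_m.-1) :
  hurwitz_act g (braid_sigma i) = hurwitz_move g i.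
Proof. exact: hurwitz_act_class. Qed.

Lemma hurwitz_act_action (G : groupType) (m : nat) :
  right_action (@hurwitz_act G m).
Proof.
split=> [g|g b c]; first exact: hurwitz_act_class.
rewrite {2 3}/hurwitz_act -hurwitz_letters_cat; exact: hurwitz_act_class.
Qed.

Definition conj_act (G : groupType) (m : nat) (g : m.-tuple G) (h : G) :
  m.-tuple G := [tuple of [seq x ^ h | x <- g]].

Definition hc_act (G : groupType) (m : nat) (g : m.-tuple G)
  (hb : (G * braid_group m)%type) : m.-tuple G :=
  hurwitz_act (conj_act g hb.1) hb.2.

Lemma conj_act_nth (G : groupType) (m : nat) (g : m.-tuple G) (h : G) (j : nat) :
  (conj_act g h)`_j = g`_j ^ h.
Proof.
have [jm|mj] := ltnP j m; first by rewrite (nth_map 1) ?size_tuple.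
by rewrite !nth_default ?size_tuple ?conj1g.
Qed.

Lemma conj_act_hurwitz_move (G : groupType) (m : nat) (g : m.-tuple G) (h : G)
    (i : 'I_m.-1) :
  hurwitz_move (conj_act g h) i = conj_act (hurwitz_move g i) h.
Proof.
apply: tuple_nth_ext => j; rewrite conj_act_nth !hurwitz_move_nth !conj_act_nth.
case: eqP => // _; case: eqP => // _.
by rewrite -!conjgM -conjgC.
Qed.

Lemma conj_act_hurwitz_letters (G : groupType) (m : nat) (g : m.-tuple G)
    (h : G) (w : letters 'I_m.-1) :
  hurwitz_letters (conj_act g h) w = conj_act (hurwitz_letters g w) h.
Proof.
elim: w g => [|[i b] w IHw] g //; rewrite /hurwitz_letters /=.
rewrite -[RHS]IHw; congr foldl; case: b; first exact: conj_act_hurwitz_move.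
by rewrite -[in LHS](hurwitz_move_invK g i) -conj_act_hurwitz_move hurwitz_moveK.
Qed.

Lemma conj_act_action (G : groupType) (m : nat) : right_action (@conj_act G m).
Proof.
by split=> [g|g h k]; apply: tuple_nth_ext => j;
   rewrite !conj_act_nth ?conjg1 ?conjgM.
Qed.

Lemma hc_act_action (G : groupType) (m : nat) : right_action (@hc_act G m).
Proof.
have [H1 HM] := hurwitz_act_action G m; have [C1 CM] := conj_act_action G m.
split=> [g|g [h b] [k c]]; first by rewrite /hc_act C1 H1.
by rewrite /hc_act /= CM HM {2}/hurwitz_act conj_act_hurwitz_letters.
Qed.

Definition hurwitz_equiv (G : groupType) (m : nat) (g g' : m.-tuple G) : Prop :=
  same_orbit (@hurwitz_act G m) g g'.

Definition hc_equiv (G : groupType) (m : nat) (g g' : m.-tuple G) : Prop :=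
  same_orbit (@hc_act G m) g g'.

Definition coxeter_element (G : groupType) (m : nat) (g : m.-tuple G) : G :=
  \prod_(x <- g) x.

Definition conjugate (G : groupType) (x y : G) : Prop :=
  exists h : G, x ^ h = y.

Definition generator_system (n : nat) (M : coxeter_matrix n) (m : nat)
  (a : m.-tuple (artin_group M)) : Prop :=
  forall j : 'I_m, exists i : 'I_n, tnth a j = artin_gen M i.

(* Main.v *)
Require Import Defs.
From HB Require Import structures.
From mathcomp Require Import all_boot all_order all_algebra boolp.
From mathcomp Require Import zify ring lra.

(** A Hurwitz move replaces two consecutive entries [x, y] by [y, y^-1 x y], so
    it does not change the product of the system, and simultaneous conjugation
    conjugates that product.  This gives the direct implications; the converse
    ones are statements about words.

    Part (1).  Write the two systems as positive words [u] and [v] representing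
    the same element of the Artin group.  Then [u] and [v] can be transformed
    into each other by replacing one side of a defining relation by the other,
    without using inverses: Artin monoids embed in Artin groups, a theorem of
    L. Paris ([presented_eq_monoid]).  Each such replacement is a sequence of
    Hurwitz moves ([hurwitz_altword]): moving the last letter [x] of an
    alternating word [P x] to the front turns it into [P x P^-1], and the
    relation [P x = y P] says that this is the other generator [y].

    The embedding is proved with the Lawrence-Krammer-Paris representation, in
    the spirit of J.-Y. Hee.  First suppose that all labels are 2 or 3.  Positive
    words act on functions on the positive real roots through operators [psi z s]
    depending on a rational number [z].  For [z != 0] these operators are
    bijective, so that words equal in the group act in the same way; the
    dependence on [z] being polynomial, they also act in the same way for
    [z = 0] ([steps_of_psis]).  There the operators [step s] are no longer
    invertible but have nonnegative coefficients, and the left divisors of a word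
    can be read off: [s] divides the word iff the word annihilates the indicator
    function of the simple root of [s].  Left divisors being detected, letters
    are cancelled one after the other.

    The existence of the representation rests on linear forms, here [defect],
    which must satisfy identities with respect to [step].  They are obtained by
    attaching to each root a bilinear form, transported along reflections by an
    affine deformation of the tensor square of the Burau representation.  The
    value of [defect] measures by how much the linear Burau action [rho] differs
    on this form from the action [step] ([rho_bform]); the identities then follow
    from the braid relations of both actions by comparing coefficients
    ([step_defect_far], [step_defect_adj]).

    Arbitrary labels are reduced to labels 2 and 3 by folding: a generator [i] is
    sent to the product of the commuting nodes [(i, 0), ..., (i, N-1)] of a graph
    in which the nodes over two generators with label [k] form disjoint paths
    with [k - 1] nodes.  The alternating products of length [k] of the two colour
    classes of such a path are equal ([path_braid]), and left divisors are still
    detected, by following roots that are supported on segments of the paths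
    ([vanishes_travel]).  An infinite label is replaced by an integer larger than
    the length of the words under consideration.

    Part (2).  Let the label of any two generators be 2 or infinite, and let
    [u g = g v] with [u], [v] positive and [g] a reduced word.  If [u g] is not
    reduced, the last letter of [u], up to commutations, cancels the first one of
    [g]; rotating [u] shortens [g].  The same holds for [g v].  If both words are
    reduced, the normal form theorem ([reduced_class_trace]) shows that the first
    letter of [g] is either the first letter of [u], which is then rotated, or
    commutes with [u].  As rotations come from conjugation and Hurwitz moves, an
    induction on the length of [g] concludes ([conjugate_hc_words]). *)

Set Implicit Arguments.
Unset Strict Implicit.
Unset Printing Implicit Defensive.

Import Order.TTheory GRing.Theory Num.Theory.

(** * Roots of a simply laced graph, with their bilinear forms *)

Local Open Scope ring_scope.

(** The form of a root moves, under a simple reflection, by an operator or by its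
    inverse according to the sign of a weight [c]; for [c = 0] it is fixed. *)
Definition signed (T : Type) (u u' : T -> T) (c : int) (x : T) : T :=
  if c < 0 then u x else if 0 < c then u' x else x.

Section Signed.
Variables (T : Type) (u u' v v' : T -> T).
Hypotheses (uK : cancel u u') (u'K : cancel u' u).
Hypotheses (vK : cancel v v') (v'K : cancel v' v).

Lemma signedK c : cancel (signed u u' c) (signed u u' (- c)).
Proof.
by move=> x; rewrite /signed oppr_lt0 oppr_gt0; case: ltgtP.
Qed.

Lemma signed_comm c d x : (forall z, u (v z) = v (u z)) ->
  signed u u' c (signed v v' d x) = signed v v' d (signed u u' c x).
Proof.
move=> uv.
have uv' z : u (v' z) = v' (u z) by rewrite -[z in RHS]v'K uv vK.
have u'v z : u' (v z) = v (u' z) by rewrite -[z in LHS]u'K -uv uK.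
have u'v' z : u' (v' z) = v' (u' z) by rewrite -[z in LHS]u'K -uv' uK.
by rewrite /signed; case: (ltgtP c 0) => _ //; case: (ltgtP d 0).
Qed.

(** Along the orbit of a root under two adjacent reflections, whose weights start
    at [g] and [h], the weights met are [g], [g + h], [h] in one direction and
    [h], [g + h], [g] in the other.  Whatever their signs, the two products agree
    because of the braid relation. *)
Lemma signed_braid g h x : (forall z, u (v (u z)) = v (u (v z))) ->
  signed u u' h (signed v v' (g + h) (signed u u' g x))
  = signed v v' g (signed u u' (g + h) (signed v v' h x)).
Proof.
move=> uvu.
have u'v'u' z : u' (v' (u' z)) = v' (u' (v' z)).
  apply: (can_inj uK); apply: (can_inj vK); apply: (can_inj uK).
  by rewrite [RHS]uvu !(u'K, v'K).
have uvu' z : u (v (u' z)) = v' (u (v z)) by rewrite -[z in RHS]u'K uvu vK.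
have vuv' z : v (u (v' z)) = u' (v (u z)) by rewrite -[z in RHS]v'K -uvu uK.
have u'v'u z : u' (v' (u z)) = v (u' (v' z)) by rewrite -[z in RHS]uK u'v'u' v'K.
have v'u'v z : v' (u' (v z)) = u (v' (u' z)) by rewrite -[z in RHS]vK -u'v'u' u'K.
rewrite /signed; case: (ltgtP g 0) => g0; case: (ltgtP h 0) => h0;
  case: (ltgtP (g + h) 0) => gh0; first
    [by []|by lia|by rewrite ?uK ?u'K ?vK ?v'K].
Qed.
End Signed.

Section Roots.
Variables (I : eqType) (adj : rel I).
Hypothesis adj_sym : symmetric adj.
Hypothesis adj_irr : irreflexive adj.

Definition cartan (s r : I) : int :=
  if s == r then 2 else if adj s r then -1 else 0.

(** The Gram matrix of the Burau representation with [1 + y] on the diagonal and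
    [- sqrt y] for adjacent nodes, where [y = 1 / 4].  Any [0 < y < 1] with a
    rational square root would do. *)
Definition qcartan (s r : I) : rat :=
  if s == r then 5 / 4 else if adj s r then - (1 / 2) else 0.

(** Coordinates are dual: a bilinear form is an element of the tensor square of
    the space of functions on the nodes, in which row [s] of [qcartan] plays the
    role of the simple root of [s].  This makes the reflections below finite
    expressions even when a node has many neighbours. *)
Definition form := I -> I -> rat.

(** The tensor square of the Burau reflection [m |-> m - m s *: qcartan s]. *)
Definition rho (s : I) (P : form) : form := fun i j =>
  P i j - qcartan s i * P s j - P i s * qcartan s j
  + P s s * qcartan s i * qcartan s j.

(** The inverse of [rho s] followed by a translation by [-3 = - (1 - y) / y]
    times [qcartan s] tensor itself.  This map fixes [1 / 4 * qcartan i j], so it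
    is the conjugate of the inverse of [rho s] by the translation by that form,
    and the braid relations carry over.  The coefficient 3 is the only one for
    which two adjacent simple roots give the same form to their sum, see
    [reflect_state_simple]. *)
Definition raise_form (s : I) (P : form) : form := fun i j =>
  P i j - 4 * qcartan s i * P s j - 4 * P i s * qcartan s j
  + 16 * P s s * qcartan s i * qcartan s j - 3 * qcartan s i * qcartan s j.

Definition lower_form (s : I) (P : form) : form := fun i j =>
  rho s P i j + 3 / 16 * qcartan s i * qcartan s j.

Lemma qcartan_diag s : qcartan s s = 5 / 4.
Proof. by rewrite /qcartan eqxx. Qed.

Lemma qcartan_far s t : s != t -> ~~ adj s t -> qcartan s t = 0.
Proof. by rewrite /qcartan => /negPf -> /negPf ->. Qed.

Lemma adj_neq s t : adj s t -> s != t.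
Proof. by move=> st; apply/eqP => e; rewrite e adj_irr in st. Qed.

Lemma qcartan_adj s t : adj s t -> qcartan s t = - (1 / 2).
Proof. by move=> st; rewrite /qcartan (negPf (adj_neq st)) st. Qed.

Lemma raise_formK s : cancel (raise_form s) (lower_form s).
Proof.
move=> P; apply/funext => i; apply/funext => j.
rewrite /lower_form /rho /raise_form. rewrite !qcartan_diag.
by field.
Qed.

Lemma lower_formK s : cancel (lower_form s) (raise_form s).
Proof.
move=> P; apply/funext => i; apply/funext => j.
rewrite /lower_form /rho /raise_form. rewrite !qcartan_diag.
by field.
Qed.

Lemma raise_form_comm s t P : s != t -> ~~ adj s t ->
  raise_form s (raise_form t P) = raise_form t (raise_form s P).
Proof.
move=> st nst; apply/funext => i; apply/funext => j.
have ts : ~~ adj t s by rewrite adj_sym.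
have ts' : t != s by rewrite eq_sym.
rewrite /raise_form ?qcartan_diag !(qcartan_far st nst) !(qcartan_far ts' ts).
ring.
Qed.

Lemma raise_form_braid s t P : adj s t ->
  raise_form s (raise_form t (raise_form s P))
  = raise_form t (raise_form s (raise_form t P)).
Proof.
move=> st; apply/funext => i; apply/funext => j.
have ts : adj t s by rewrite adj_sym.
rewrite /raise_form !qcartan_diag !(qcartan_adj st) !(qcartan_adj ts).
by field.
Qed.

Lemma cartan_diag s : cartan s s = 2.
Proof. by rewrite /cartan eqxx. Qed.

Lemma cartan_far s t : s != t -> ~~ adj s t -> cartan s t = 0.
Proof. by rewrite /cartan => /negPf -> /negPf ->. Qed.

Lemma cartan_adj s t : adj s t -> cartan s t = -1.
Proof. by move=> st; rewrite /cartan (negPf (adj_neq st)) st. Qed.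

(** A candidate root, given by what the construction needs: its depth, its inner
    products with the simple roots and its bilinear form.  The depth keeps apart
    roots with the same inner products when the Cartan matrix is singular. *)
Record state := State {depth : int; weight : I -> int; bform : form}.

Definition move_form (s : I) : int -> form -> form :=
  signed (raise_form s) (lower_form s).

Definition reflect_state (s : I) (x : state) : state :=
  State (depth x - sgz (weight x s))
    (fun r => weight x r - weight x s * cartan s r)
    (move_form s (weight x s) (bform x)).

Lemma reflect_state_fix s x : weight x s = 0 -> reflect_state s x = x.
Proof.
case: x => d w P /= ws; rewrite /reflect_state /= ws sgz0 subr0 /move_form /signed ltxx.
by congr State; apply/funext => r; rewrite mul0r subr0.
Qed.

Lemma reflect_stateK s : involutive (reflect_state s).
Proof.
case=> d w P; rewrite /reflect_state /= cartan_diag; congr State.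
- have -> : w s - w s * 2 = - w s by ring.
  by rewrite sgzN; ring.
- by apply/funext => r; ring.
- have -> : w s - w s * 2 = - w s by ring.
  exact: (signedK (@raise_formK s) (@lower_formK s)).
Qed.

Lemma move_form_comm s t c d P : s != t -> ~~ adj s t ->
  move_form s c (move_form t d P) = move_form t d (move_form s c P).
Proof.
move=> st nst.
exact: (signed_comm (@raise_formK s) (@lower_formK s) (@raise_formK t)
  (@lower_formK t) c d P (fun z => raise_form_comm z st nst)).
Qed.

Lemma reflect_state_comm s t x : s != t -> ~~ adj s t ->
  reflect_state s (reflect_state t x) = reflect_state t (reflect_state s x).
Proof.
move=> st nst; case: x => d w P; rewrite /reflect_state /=.
rewrite (cartan_far st nst) (cartan_far (s := t) (t := s)) 1?adj_sym 1?eq_sym //.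
rewrite !mulr0 !subr0 move_form_comm //; congr State; first by ring.
by apply/funext => r; ring.
Qed.

Lemma move_form_braid s t g h P : adj s t ->
  move_form s h (move_form t (g + h) (move_form s g P))
  = move_form t g (move_form s (g + h) (move_form t h P)).
Proof.
move=> st.
exact: (signed_braid (@raise_formK s) (@lower_formK s) (@raise_formK t)
  (@lower_formK t) g h P (fun z => raise_form_braid z st)).
Qed.

Lemma reflect_state_braid s t x : adj s t ->
  reflect_state s (reflect_state t (reflect_state s x))
  = reflect_state t (reflect_state s (reflect_state t x)).
Proof.
move=> st; have ts : adj t s by rewrite adj_sym.
case: x => d w P; rewrite /reflect_state /= !cartan_diag.
rewrite (cartan_adj st) (cartan_adj ts).
set g := w s; set h := w t.
have -> : h - g * -1 = g + h by ring.
have -> : g - h * -1 = g + h by ring.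
have -> : g - g * 2 - (g + h) * -1 = h by ring.
have -> : h - h * 2 - (g + h) * -1 = g by ring.
by rewrite move_form_braid //; congr State; [ring|apply/funext => r; ring].
Qed.

Definition simple (s : I) : state :=
  State 0 (cartan s) (fun i j => qcartan s i * qcartan s j).

(** Roots are built from simple roots by reflections that increase the depth, so
    that positivity holds by construction; the content is moved to
    [reached_down]. *)
Inductive reached : nat -> state -> Prop :=
| reached_simple s : reached 0 (simple s)
| reached_reflect n s x :
    reached n x -> weight x s < 0 -> reached n.+1 (reflect_state s x).

Lemma reached_depth n x : reached n x -> depth x = n%:Z.
Proof.
elim=> // {}n s {}x _ IH xs /=.
by rewrite IH; move: xs; rewrite -sgz_lt0; case: sgzP => // _ _; lia.
Qed.

Lemma reflect_state_simple s t : adj s t ->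
  reflect_state t (simple s) = reflect_state s (simple t).
Proof.
move=> st; have ts : adj t s by rewrite adj_sym.
rewrite /reflect_state /simple /= (cartan_adj st) (cartan_adj ts).
congr State; first by apply/funext => r; ring.
apply/funext => i; apply/funext => j.
rewrite /move_form /signed /= /raise_form (qcartan_adj st) (qcartan_adj ts).
by field.
Qed.

Lemma weight_simple_lt2 s r : r != s -> weight (simple s) r <= 0.
Proof. by rewrite /= /cartan eq_sym => /negPf ->; case: ifP. Qed.

(** Positive roots other than the simple root of [s] are permuted by the
    reflection [s].  For a reflection that decreases the depth this goes by
    induction on the depth: if the root was obtained by raising along an adjacent
    node [t], descend along [s], [t] and climb back along [s], [t], using the
    braid relation. *)
Lemma reached_down n x s : reached n x -> 0 < weight x s -> x <> simple s ->
  exists2 k, n = k.+1 & reached k (reflect_state s x).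
Proof.
elim/ltn_ind: n x s => n0 IH x0 s rn.
case: {n0 x0} rn IH => [r|n t x] => [_|rx xt IH].
  case: (eqVneq s r) => [-> //|sr].
  by have := weight_simple_lt2 sr; lia.
case: (eqVneq s t) => [->|st] xs _.
  by exists n => //; rewrite reflect_stateK.
have [adjst|nst] := boolP (adj s t); last first.
  have nts : ~~ adj t s by rewrite adj_sym.
  have ts : t != s by rewrite eq_sym.
  move: xs; rewrite /= (cartan_far ts nts) mulr0 subr0 => xs.
  case: (IH n _ x s) => // [xE|k nE rk].
    by move: xt; rewrite xE /= cartan_far.
  exists n => //; rewrite -reflect_state_comm // nE; apply: reached_reflect => //=.
  by rewrite cartan_far // mulr0 subr0.
have ts : adj t s by rewrite adj_sym.
move: xs; rewrite /= (cartan_adj ts) => xs.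
have [xE|xE] := pselect (x = simple s).
  exists n => //; rewrite xE reflect_state_simple // reflect_stateK.
  have -> : n = 0%N by have := reached_depth rx; rewrite xE /=; lia.
  exact: reached_simple.
case: (IH n _ x s) => // [|k nE rk]; first lia.
have wt : weight (reflect_state s x) t = weight x t + weight x s.
  by rewrite /= (cartan_adj adjst); ring.
have ws : weight (reflect_state s x) s = - weight x s.
  by rewrite /= cartan_diag; ring.
case: (IH k _ (reflect_state s x) t) => // [|||l kE rl]; first by lia.
- by rewrite wt; lia.
- by move=> e; move: ws; rewrite e /= (cartan_adj ts); lia.
have ws2 : weight (reflect_state t (reflect_state s x)) s = weight x t.
  by rewrite [LHS]/= cartan_diag (cartan_adj ts) (cartan_adj adjst); ring.
have wt2 : weight (reflect_state t (reflect_state s x)) t = - (weight x t + weight x s).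
  by rewrite [LHS]/= cartan_diag (cartan_adj adjst); ring.
exists n => //; rewrite -[reflect_state s _](reflect_stateK t) -reflect_state_braid //.
rewrite nE; apply: reached_reflect.
  rewrite kE; apply: reached_reflect => //; rewrite ws2 //.
change (weight (reflect_state t (reflect_state s x)) t
  - weight (reflect_state t (reflect_state s x)) s
  * cartan s t < 0).
by rewrite ws2 wt2 (cartan_adj adjst); lia.
Qed.

Definition rank_one (s : I) : form := fun i j => qcartan s i * qcartan s j.

Lemma bform_reflect_up s x : weight x s < 0 ->
  bform (reflect_state s x) = raise_form s (bform x).
Proof. by move=> ws; rewrite /= /move_form /signed ws. Qed.

(** A root orthogonal to [t] has a form that [rho t] fixes up to a multiple of
    [rank_one t].  When the root was raised along a node [u] adjacent to [t], it
    is obtained from a root orthogonal to [u] by raising along [t] and then along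
    [u], and the braid relation turns the claim for [u] into the claim for
    [t]. *)
Lemma reached_fixed n x t : reached n x -> weight x t = 0 ->
  exists c, forall i j, rho t (bform x) i j = bform x i j + c * rank_one t i j.
Proof.
elim/ltn_ind: n x t => n0 IH x0 t rn.
case: {n0 x0} rn IH => [s|n u x] => [_|rx xu IH].
  move=> /= wt; exists 0 => i j.
  have st : s != t by apply: contraTneq isT => e; rewrite e cartan_diag in wt.
  have nst : ~~ adj s t by apply/negP => e; rewrite cartan_adj in wt.
  by rewrite /rho /rank_one /= (qcartan_far st nst); ring.
have bE := bform_reflect_up xu; move=> wt; rewrite bE.
case: (eqVneq u t) => [ut|ut].
  by move: wt; rewrite -ut /= cartan_diag; lia.
have tu : t != u by rewrite eq_sym.
have [adjut|nut] := boolP (adj u t); last first.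
  have ntu : ~~ adj t u by rewrite adj_sym.
  move: wt; rewrite /= (cartan_far ut nut) mulr0 subr0 => wt.
  have [//|c cE] := IH n _ x t rx wt; exists c => i j.
  have -> : rho t (raise_form u (bform x)) i j
    = raise_form u (rho t (bform x)) i j.
    rewrite /rho /raise_form (qcartan_far ut nut) (qcartan_far tu ntu).
    by ring.
  rewrite /raise_form !cE /rank_one (qcartan_far tu ntu); by ring.
have adjtu : adj t u by rewrite adj_sym.
move: wt; rewrite /= (cartan_adj adjut) => wt.
have xt : x <> simple t by move=> e; move: wt; rewrite e /= cartan_diag cartan_adj.
have [|k nE rk] := reached_down rx _ xt; first by lia.
have wu : weight (reflect_state t x) u = 0 by rewrite /= (cartan_adj adjtu); lia.
have [|c cE] := IH k _ _ u rk wu; first by lia.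
have -> : bform x = raise_form t (bform (reflect_state t x)).
  rewrite -[in LHS](reflect_stateK t x) bform_reflect_up //= cartan_diag; lia.
(* Raising along [t] and [u] turns row [u] of [qcartan] into twice row [t], hence
   the factor 4; the constant comes from the translations in [raise_form]. *)
move: (bform _) cE => P cE; exists (4 * c + 9 / 16) => i j.
have -> : rho t (raise_form u (raise_form t P)) i j
  = raise_form u (raise_form t (rho u P)) i j + 9 / 16 * rank_one t i j.
  rewrite /rank_one /rho /raise_form !qcartan_diag (qcartan_adj adjut).
  by rewrite (qcartan_adj adjtu); field.
rewrite /raise_form !cE /rank_one !qcartan_diag (qcartan_adj adjut).
by rewrite (qcartan_adj adjtu); field.
Qed.

Record real_root := RealRoot {
  root_state :> state;
  root_reached : exists n, reached n root_state }.

HB.instance Definition _ := gen_eqMixin real_root.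

Lemma root_inj (x y : real_root) : x = y :> state -> x = y.
Proof.
case: x y => [x rx] [y ry] /= xy; subst y.
by rewrite (Prop_irrelevance rx ry).
Qed.

Definition simple_root (s : I) : real_root :=
  RealRoot (ex_intro _ 0%N (reached_simple s)).

Lemma reflect_state_reached s x : (exists n, reached n x) -> x <> simple s ->
  exists n, reached n (reflect_state s x).
Proof.
move=> [n rx] xs; case: (ltgtP (weight x s) 0) => ws.
- by exists n.+1; apply: reached_reflect.
- by have [k _ rk] := reached_down rx ws xs; exists k.
- by exists n; rewrite reflect_state_fix.
Qed.

(** The reflection [s] maps the simple root of [s] to a negative root; fixing it
    instead makes [refl s] a total involution. *)
Definition refl (s : I) (x : real_root) : real_root :=
  match pselect (x = simple s :> state) with
  | left _ => x
  | right xs => RealRoot (reflect_state_reached (root_reached x) xs)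
  end.

Lemma refl_simple s : refl s (simple_root s) = simple_root s.
Proof. by rewrite /refl; case: pselect. Qed.

Lemma reflE s (x : real_root) : x != simple_root s ->
  refl s x = reflect_state s x :> state.
Proof.
move=> /eqP xs; rewrite /refl; case: pselect => // e; case: xs.
exact: root_inj.
Qed.

Lemma weight_refl s (x : real_root) r : x != simple_root s ->
  weight (refl s x) r = weight x r - weight x s * cartan s r.
Proof. by move=> xs; rewrite reflE. Qed.

Lemma weight_simple s r : weight (simple_root s) r = cartan s r.
Proof. by []. Qed.

(** Only a root of weight [-2] at [s] could be sent to the simple root of [s];
    but such a root is raised by [s], and the simple root has depth 0. *)
Lemma refl_neq s (x : real_root) : x != simple_root s -> refl s x != simple_root s.
Proof.
move=> xs; apply/eqP => e.
have rE : reflect_state s x = simple s by rewrite -reflE // e.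
have ws : weight x s = -2.
  have : weight (reflect_state s x) s = 2 by rewrite rE /= cartan_diag.
  by rewrite /= cartan_diag; lia.
have [n rx] := root_reached x.
have := reached_depth rx; have : depth (reflect_state s x) = 0 by rewrite rE.
by rewrite /= ws; lia.
Qed.

Lemma refl_neqE s (x : real_root) : (refl s x == simple_root s) = (x == simple_root s).
Proof.
case: (eqVneq x (simple_root s)) => [->|xs]; first by rewrite refl_simple eqxx.
exact: negPf (refl_neq xs).
Qed.

Lemma reflK s : involutive (refl s).
Proof.
move=> x; case: (eqVneq x (simple_root s)) => [->|xs].
  by rewrite !refl_simple.
by apply: root_inj; rewrite !reflE ?refl_neq // reflect_stateK.
Qed.

Lemma refl_fix s (x : real_root) : weight x s = 0 -> refl s x = x.
Proof.
case: (eqVneq x (simple_root s)) => [->|xs ws]; first by rewrite refl_simple.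
by apply: root_inj; rewrite reflE // reflect_state_fix.
Qed.

Lemma refl_simple_far s t : s != t -> ~~ adj s t ->
  refl s (simple_root t) = simple_root t.
Proof.
by move=> st nst; apply: refl_fix; rewrite weight_simple cartan_far 1?eq_sym // adj_sym.
Qed.

Lemma refl_eq_simple_far s t x : s != t -> ~~ adj s t ->
  (refl s x == simple_root t) = (x == simple_root t).
Proof.
by move=> st nst; rewrite -[RHS](inj_eq (can_inj (reflK s))) refl_simple_far.
Qed.

Lemma refl_comm s t x : s != t -> ~~ adj s t -> refl s (refl t x) = refl t (refl s x).
Proof.
move=> st nst; have ts : t != s by rewrite eq_sym.
have nts : ~~ adj t s by rewrite adj_sym.
case: (eqVneq x (simple_root s)) => [->|xs].
  by rewrite refl_simple !(refl_simple_far ts nts) refl_simple.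
case: (eqVneq x (simple_root t)) => [->|xt].
  by rewrite refl_simple !(refl_simple_far st nst) refl_simple.
apply: root_inj; rewrite !reflE ?refl_eq_simple_far //.
exact: reflect_state_comm.
Qed.

Lemma simple_root_inj : injective simple_root.
Proof.
move=> s t e; apply/eqP; apply: contraTT isT => st.
have := weight_simple s s; rewrite e weight_simple cartan_diag /cartan.
by rewrite eq_sym (negPf st); case: ifP.
Qed.

Lemma refl_simple_adj s t : adj s t ->
  refl t (simple_root s) = refl s (simple_root t).
Proof.
move=> st; have ne : s != t := adj_neq st.
apply: root_inj; rewrite !reflE ?(inj_eq simple_root_inj) //; last by rewrite eq_sym.
exact: reflect_state_simple.
Qed.

Lemma refl_adj_neq s t x : adj s t -> x != refl s (simple_root t) ->
  x != simple_root s -> x != simple_root t ->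
  [/\ refl s x != simple_root t & refl t (refl s x) != simple_root s].
Proof.
move=> st xst xs xt; split.
  by apply: contra xst => /eqP <-; rewrite reflK.
apply: contra xt => /eqP e.
by rewrite -[x](reflK s) -[refl s x](reflK t) e refl_simple_adj // reflK.
Qed.

(** The three excluded roots are those of the rank two system spanned by [s] and
    [t], on which some reflection meets its own simple root. *)
Lemma refl_braid s t x : adj s t -> x != refl s (simple_root t) ->
  x != simple_root s -> x != simple_root t ->
  refl s (refl t (refl s x)) = refl t (refl s (refl t x)).
Proof.
move=> st xst xs xt; have ts : adj t s by rewrite adj_sym.
have [n1 n2] := refl_adj_neq st xst xs xt.
have [|m1 m2] := refl_adj_neq ts _ xt xs; first by rewrite -refl_simple_adj.
by apply: root_inj; rewrite !reflE ?refl_neq // reflect_state_braid.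
Qed.

(** * The nonnegative action and its invertible deformation *)

(** The transpose of the operator that sends the basis vector of a root [x] to
    that of [refl s x] if the weight is nonnegative, to a convex combination of
    the vectors of [x] and [refl s x] otherwise, and to zero for the simple root
    of [s]. *)
Definition step (s : I) (f : real_root -> rat) (x : real_root) : rat :=
  if x == simple_root s then 0
  else if weight x s < 0 then 3 / 4 * f x + 1 / 4 * f (refl s x)
  else f (refl s x).

Lemma step_simple s f : step s f (simple_root s) = 0.
Proof. by rewrite /step eqxx. Qed.

Lemma stepE s f x : x != simple_root s ->
  step s f x = if weight x s < 0 then 3 / 4 * f x + 1 / 4 * f (refl s x)
               else f (refl s x).
Proof. by rewrite /step => /negPf ->. Qed.

Lemma step_linear s a b f g x :
  step s (fun z => a * f z + b * g z) x = a * step s f x + b * step s g x.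
Proof. by rewrite /step; case: ifP => _; [ring|case: ifP => _; ring]. Qed.

Lemma step_comm s t f : s != t -> ~~ adj s t ->
  step s (step t f) = step t (step s f).
Proof.
move=> st nst; have ts : t != s by rewrite eq_sym.
have nts : ~~ adj t s by rewrite adj_sym.
apply/funext => x.
case: (eqVneq x (simple_root s)) => [->|xs].
  rewrite step_simple stepE ?(inj_eq simple_root_inj) // weight_simple.
  by rewrite (cartan_far st nst) ltxx refl_simple_far // step_simple.
case: (eqVneq x (simple_root t)) => [->|xt].
  rewrite step_simple stepE ?(inj_eq simple_root_inj) // weight_simple.
  by rewrite (cartan_far ts nts) ltxx refl_simple_far // step_simple.
rewrite !stepE ?refl_eq_simple_far // !weight_refl // (cartan_far st nst).
rewrite (cartan_far ts nts) !mulr0 !subr0 (refl_comm _ st nst).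
by case: ifP => _; case: ifP => _ //; ring.
Qed.

Lemma step_braid s t f : adj s t ->
  step s (step t (step s f)) = step t (step s (step t f)).
Proof.
move=> st; have ts : adj t s by rewrite adj_sym.
have st' := adj_neq st; have ts' := adj_neq ts.
apply/funext => x.
have aux a b h : adj a b ->
    step b (step a h) (simple_root a) = 1 / 4 * h (simple_root b).
  move=> ab; have ba' := adj_neq ab.
  rewrite stepE ?(inj_eq simple_root_inj) // weight_simple (cartan_adj ab) /=.
  rewrite step_simple stepE; last first.
    by rewrite refl_simple_adj // refl_neqE (inj_eq simple_root_inj) eq_sym.
  rewrite refl_simple_adj // weight_refl ?(inj_eq simple_root_inj) 1?eq_sym //.
  rewrite weight_simple cartan_diag reflK (cartan_adj (s := b)) 1?adj_sym //=.
  by ring.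
have aux2 a b h : adj a b ->
    step a h (refl a (simple_root b)) = h (simple_root b).
  move=> ab; have ba' := adj_neq ab.
  rewrite stepE ?refl_neqE ?(inj_eq simple_root_inj) 1?eq_sym // reflK.
  rewrite weight_refl ?(inj_eq simple_root_inj) 1?eq_sym //.
  by rewrite weight_simple cartan_diag (cartan_adj (s := b)) 1?adj_sym.
case: (eqVneq x (simple_root s)) => [->|xs].
  by rewrite step_simple aux // step_simple mulr0.
case: (eqVneq x (simple_root t)) => [->|xt].
  by rewrite step_simple aux // step_simple mulr0.
case: (eqVneq x (refl s (simple_root t))) => [->|xst].
  by rewrite aux2 // step_simple -refl_simple_adj // aux2 // step_simple.
have [n1 n2] := refl_adj_neq st xst xs xt.
have [|m1 m2] := refl_adj_neq ts _ xt xs; first by rewrite -refl_simple_adj.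
have br := refl_braid st xst xs xt.
have u1 : weight (refl s x) t = weight x s + weight x t.
  by rewrite weight_refl // (cartan_adj st); ring.
have u2 : weight (refl t x) s = weight x s + weight x t.
  by rewrite weight_refl // (cartan_adj ts); ring.
have u3 : weight (refl s x) s = - weight x s.
  by rewrite weight_refl // cartan_diag; ring.
have u4 : weight (refl t x) t = - weight x t.
  by rewrite weight_refl // cartan_diag; ring.
have u5 : weight (refl t (refl s x)) s = weight x t.
  by rewrite weight_refl // u1 u3 (cartan_adj ts); ring.
have u6 : weight (refl s (refl t x)) t = weight x s.
  by rewrite weight_refl // u2 u4 (cartan_adj st); ring.
have e1 : weight x s = 0 -> refl s x = x by exact: refl_fix.
have e2 : weight x t = 0 -> refl t x = x by exact: refl_fix.
have [p1 p2] := (refl_neq xs, refl_neq xt).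
(* In generic position all six roots of the orbit avoid the simple roots of [s]
   and [t], and the signs of the weights [g], [h], [g + h] decide everything. *)
do 3!rewrite ?(stepE _ xs) ?(stepE _ xt) ?(stepE _ n1) ?(stepE _ m1)
  ?(stepE _ n2) ?(stepE _ m2) ?(stepE _ p1) ?(stepE _ p2).
rewrite u1 u2 u3 u4 u5 u6 !reflK br !oppr_lt0.
move: e1 e2; move: (weight x s) (weight x t) => g h e1 e2.
case: (ltgtP g 0) => g0; case: (ltgtP h 0) => h0; case: (ltP (g + h) 0) => gh0;
  try (exfalso; clear -g0 h0 gh0; lia); try rewrite (e1 g0); try rewrite (e2 h0);
  by field.
Qed.

Lemma step_quadratic s f x : f (simple_root s) = 0 ->
  step s (step s f) x = 3 / 4 * step s f x + 1 / 4 * f x.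
Proof.
move=> f0; case: (eqVneq x (simple_root s)) => [->|xs].
  by rewrite !step_simple f0; ring.
have e1 : weight x s = 0 -> refl s x = x by exact: refl_fix.
rewrite !(stepE _ xs) !(stepE _ (refl_neq xs)) reflK weight_refl // cartan_diag.
have -> : weight x s - weight x s * 2 = - weight x s by ring.
rewrite oppr_lt0; case: (ltgtP (weight x s) 0) => g0; try by field.
by rewrite e1 //; field.
Qed.

(** The coefficient in [rho_bform], read off at the entry [(s, s)],
    where [rho s] acts by [y ^+ 2 = 1 / 16] and [rank_one s] is
    [(1 + y) ^+ 2 = 25 / 16]. *)
Definition defect (s : I) (x : real_root) : rat :=
  16 / 25 * (1 / 16 * bform x s s - step s (fun z : real_root => bform z s s) x).

Lemma bform_refl_up s (x : real_root) : x != simple_root s -> weight x s < 0 ->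
  bform (refl s x) = raise_form s (bform x).
Proof. by move=> xs ws; rewrite reflE // bform_reflect_up. Qed.

Lemma bform_refl_down s (x : real_root) : x != simple_root s -> 0 < weight x s ->
  bform (refl s x) = lower_form s (bform x).
Proof.
by move=> xs ws; rewrite reflE //= /move_form /signed ws ltNge (ltW ws).
Qed.

(** On the forms of the roots, [rho s] and [step s] agree modulo [rank_one s].
    This is immediate for roots moved by [s], by the choice of [raise_form];
    for roots orthogonal to [s] it is [reached_fixed]. *)
Lemma rho_bform s (x : real_root) i j :
  rho s (bform x) i j
  = step s (fun z : real_root => bform z i j) x + defect s x * rank_one s i j.
Proof.
rewrite /defect; case: (eqVneq x (simple_root s)) => [->|xs].
  by rewrite !step_simple /rho /rank_one /= !qcartan_diag; field.
rewrite !stepE //; case: (ltgtP (weight x s) 0) => ws.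
- rewrite bform_refl_up // /rho /raise_form /rank_one !qcartan_diag; by field.
- rewrite bform_refl_down // /rho /lower_form /rho /rank_one !qcartan_diag; by field.
have [n rx] := root_reached x; have [c cE] := reached_fixed rx ws.
have cs : 1 / 16 * bform x s s - bform x s s = c * (25 / 16).
  have := cE s s; rewrite /rho /rank_one !qcartan_diag.
  by move: (bform x s s) => P; lra.
rewrite (refl_fix ws) cE cs; move: (bform x i j) (rank_one s i j) => P R.
by field.
Qed.

Lemma rho_step s t (H : I -> I -> real_root -> rat) x i j :
  rho s (fun a b => step t (H a b) x) i j
  = step t (fun z => rho s (fun a b => H a b z) i j) x.
Proof. by rewrite /rho /step; case: ifP => _; [ring|case: ifP => _; ring]. Qed.

Lemma rho_linear s P Q c i j :
  rho s (fun a b => P a b + c * Q a b) i j = rho s P i j + c * rho s Q i j.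
Proof. by rewrite /rho; ring. Qed.

Lemma rho_ext s P Q i j : (forall a b, P a b = Q a b) -> rho s P i j = rho s Q i j.
Proof. by move=> PQ; rewrite /rho !PQ. Qed.

Lemma step_ext s f g x : (forall z, f z = g z) -> step s f x = step s g x.
Proof. by move=> fg; rewrite /step !fg. Qed.

Lemma step_addZ s f g c x :
  step s (fun z => f z + g z * c) x = step s f x + step s g x * c.
Proof. by rewrite /step; case: ifP => _; [ring|case: ifP => _; ring]. Qed.

(** Iterating [rho_bform] expresses products of two and three operators [rho];
    comparing the expressions of two equal products then yields identities for
    [defect]. *)
Lemma rho2_bform s t (x : real_root) i j :
  rho s (rho t (bform x)) i j
  = step t (step s (fun z : real_root => bform z i j)) x
    + step t (defect s) x * rank_one s i j + defect t x * rho s (rank_one t) i j.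
Proof.
rewrite (rho_ext s i j (rho_bform t x)) rho_linear.
rewrite (rho_step s t (fun a b (z : real_root) => bform z a b)).
by rewrite (step_ext _ _ (fun z => rho_bform s z i j)) step_addZ.
Qed.

Lemma rho3_bform s t (x : real_root) i j :
  rho s (rho t (rho s (bform x))) i j
  = step s (step t (step s (fun z : real_root => bform z i j))) x
    + step s (step t (defect s)) x * rank_one s i j
    + step s (defect t) x * rho s (rank_one t) i j
    + defect s x * rho s (rho t (rank_one s)) i j.
Proof.
rewrite (rho_ext s i j (rho2_bform t s x)) !rho_linear.
rewrite (rho_step s s (fun a b => step t (fun z : real_root => bform z a b))).
rewrite (step_ext _ _
  (fun z => rho_step s t (fun a b (z : real_root) => bform z a b) z i j)).
rewrite (step_ext _ _ (fun z => step_ext t z (fun w => rho_bform s w i j))).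
by rewrite (step_ext _ _ (fun z => step_addZ _ _ _ _ _)) step_addZ.
Qed.

Lemma step_defect_far s t : s != t -> ~~ adj s t -> step t (defect s) = defect s.
Proof.
move=> st nst; have ts : t != s by rewrite eq_sym.
have nts : ~~ adj t s by rewrite adj_sym.
apply/funext => x.
have : rho s (rho t (bform x)) s s = rho t (rho s (bform x)) s s.
  by rewrite /rho (qcartan_far st nst) (qcartan_far ts nts); ring.
rewrite !rho2_bform (step_comm _ st nst) /rho /rank_one !qcartan_diag.
rewrite (qcartan_far ts nts).
by move: (defect s x) (defect t x) (step t _ x) (step t _ x) => a b c d; lra.
Qed.

(** The forms [rank_one s], [rank_one t] and the mixed term are linearly
    independent already on the entries indexed by [s] and [t]; the identity is
    the one of the mixed coefficients. *)
Lemma step_defect_adj s t : adj s t -> step s (defect t) = step t (defect s).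
Proof.
move=> st; have ts : adj t s by rewrite adj_sym.
apply/funext => x.
have br i j : rho s (rho t (rho s (bform x))) i j = rho t (rho s (rho t (bform x))) i j.
  rewrite /rho !qcartan_diag (qcartan_adj st) (qcartan_adj ts); by field.
have key i j : step s (step t (defect s)) x * rank_one s i j
    + step s (defect t) x * rho s (rank_one t) i j
    + defect s x * rho s (rho t (rank_one s)) i j
  = step t (step s (defect t)) x * rank_one t i j
    + step t (defect s) x * rho t (rank_one s) i j
    + defect t x * rho t (rho s (rank_one t)) i j.
  have := br i j; rewrite !rho3_bform (step_braid _ st) -!addrA.
  exact: addrI.
move: (key s s) (key s t) (key t t).
rewrite /rho /rank_one !qcartan_diag (qcartan_adj st) (qcartan_adj ts).
move: (step s _ x) (step t _ x) (defect s x) (defect t x) (step s (defect t) x).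
move=> a b c d e.

lra.
Qed.

Lemma defect_simple_neq s t : s != t -> defect s (simple_root t) = 0.
Proof.
move=> st; have ts : t != s by rewrite eq_sym.
have nst : simple_root t != simple_root s by rewrite (inj_eq simple_root_inj).
rewrite /defect stepE // weight_simple.
have [adjts|nts] := boolP (adj t s).
  have adjst : adj s t by rewrite adj_sym.
  rewrite (cartan_adj adjts) /= bform_refl_up //; last first.
    by rewrite weight_simple (cartan_adj adjts).
  by rewrite /raise_form /= !qcartan_diag (qcartan_adj adjts); lra.
have nst' : ~~ adj s t by rewrite adj_sym.
by rewrite (cartan_far ts nts) /= refl_simple_far //= (qcartan_far ts nts); lra.
Qed.

(** The Lawrence-Krammer-Paris operator, acting on functions on the roots.  The
    rank one term makes it invertible for [z != 0]. *)
Definition psi (z : rat) (s : I) (f : real_root -> rat) (x : real_root) : rat :=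
  step s f x + defect s x * (z * f (simple_root s)).

Lemma step_simple_far s t f : s != t -> ~~ adj s t ->
  step t f (simple_root s) = f (simple_root s).
Proof.
move=> st nst; have ts : t != s by rewrite eq_sym.
have nts : ~~ adj t s by rewrite adj_sym.
rewrite stepE ?(inj_eq simple_root_inj) // weight_simple (cartan_far st nst) ltxx.
by rewrite refl_simple_far.
Qed.

Lemma step_simple_adj s t f : adj s t ->
  step t f (simple_root s)
  = 3 / 4 * f (simple_root s) + 1 / 4 * f (refl t (simple_root s)).
Proof.
move=> st; have ne := adj_neq st.
by rewrite stepE ?(inj_eq simple_root_inj) // weight_simple (cartan_adj st).
Qed.

Lemma defect_simple s : defect s (simple_root s) = 1 / 16.
Proof. by rewrite /defect step_simple /= !qcartan_diag; field. Qed.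

Lemma psi_comm z s t f : s != t -> ~~ adj s t ->
  psi z s (psi z t f) = psi z t (psi z s f).
Proof.
move=> st nst; have ts : t != s by rewrite eq_sym.
have nts : ~~ adj t s by rewrite adj_sym.
apply/funext => x; rewrite {1 3}/psi.
rewrite (step_addZ s _ (defect t)) (step_addZ t _ (defect s)) (step_comm _ st nst).
rewrite (step_defect_far st nst) (step_defect_far ts nts) /psi.
rewrite !step_simple_far // !defect_simple_neq //.
by move: (defect s x) (defect t x) (f _) (f _) (step _ _ x) => a b c d e; ring.
Qed.

Lemma psi_psi z s t f x : adj s t ->
  psi z t (psi z s f) x = step t (step s f) x
    + step t (defect s) x * (z * f (simple_root s))
    + defect t x * (z * (3 / 4 * f (simple_root t)
                       + 1 / 4 * f (refl s (simple_root t)))).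
Proof.
move=> st; have ts : adj t s by rewrite adj_sym.
rewrite {1}/psi (step_addZ _ _ (defect s)); congr (_ + _ * (_ * _)).
by rewrite /psi step_simple_adj // defect_simple_neq ?adj_neq // mul0r addr0.
Qed.

(** The terms in [z] cancel because [defect s], transported by [step t],
    vanishes at the simple root of [s]. *)
Lemma psi_psi_simple z s t f : adj s t ->
  psi z t (psi z s f) (simple_root s) = 1 / 4 * f (simple_root t).
Proof.
move=> st; have ts : adj t s by rewrite adj_sym.
have [ne ne'] := (adj_neq st, adj_neq ts).
rewrite psi_psi // (step_simple_adj _ st) step_simple.
rewrite -(step_defect_adj st) step_simple defect_simple_neq //.
rewrite refl_simple_adj // stepE; last first.
  by rewrite refl_neqE (inj_eq simple_root_inj).
rewrite weight_refl ?(inj_eq simple_root_inj) // weight_simple (cartan_adj ts).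
rewrite cartan_diag reflK /=; move: (f _) => a; ring.
Qed.

Lemma psi_braid z s t f : adj s t ->
  psi z s (psi z t (psi z s f)) = psi z t (psi z s (psi z t f)).
Proof.
move=> st; have ts : adj t s by rewrite adj_sym.
have [ne ne'] := (adj_neq st, adj_neq ts).
have half a b (h : real_root -> rat) x : adj a b ->
    psi z a (psi z b (psi z a h)) x
    = step a (step b (step a h)) x
      + (3 / 4 * step b (defect a) x + 1 / 4 * defect b x) * (z * h (simple_root a))
      + step b (defect a) x * (z * (3 / 4 * h (simple_root b)
          + 1 / 4 * h (refl a (simple_root b))))
      + defect a x * (z * (1 / 4 * h (simple_root b))).
  move=> ab; rewrite {1}/psi (psi_psi_simple _ _ ab).
  rewrite (step_ext _ _ (fun w => psi_psi z h w ab)).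
  rewrite (step_addZ _ _ (defect b)) (step_addZ _ _ (step b (defect a))).
  rewrite -(step_defect_adj ab) step_quadratic // defect_simple_neq //.
  by rewrite eq_sym adj_neq.
apply/funext => x; rewrite !half // (step_braid _ st) (step_defect_adj st).
rewrite (refl_simple_adj ts); move: (defect s x) (defect t x) (f (refl _ _)).
by move: (step t (defect s) x) (step _ _ x) (f _) (f _) => a b c d e h k; ring.
Qed.

(** The value at the simple root is recovered first, from [defect_simple]; the
    rank one term can then be subtracted and the equations on the pairs
    [x, refl s x] are triangular. *)
Definition psi_inv (z : rat) (s : I) (g : real_root -> rat) (x : real_root) : rat :=
  let a := 16 * g (simple_root s) / z in
  let h w := g w - defect s w * (z * a) in
  if x == simple_root s then a
  else if weight x s <= 0 then h (refl s x) else 4 * h (refl s x) - 3 * h x.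

Lemma psiK z s : z != 0 -> cancel (psi z s) (psi_inv z s).
Proof.
move=> z0 f; apply/funext => x; rewrite /psi_inv.
have -> : 16 * psi z s f (simple_root s) / z = f (simple_root s).
  by rewrite /psi step_simple defect_simple; field.
case: eqP => [-> //|/eqP xs]; rewrite /psi !addrK.
rewrite !(stepE _ xs) !(stepE _ (refl_neq xs)) weight_refl // cartan_diag reflK.
have -> : weight x s - weight x s * 2 = - weight x s by ring.
rewrite oppr_lt0; by case: (ltgtP (weight x s) 0) => // ws; field.
Qed.

Lemma psi_invK z s : z != 0 -> cancel (psi_inv z s) (psi z s).
Proof.
move=> z0 g; apply/funext => x; rewrite /psi.
have -> : psi_inv z s g (simple_root s) = 16 * g (simple_root s) / z.
  by rewrite /psi_inv eqxx.
case: (eqVneq x (simple_root s)) => [->|xs].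
  by rewrite step_simple defect_simple; field.
rewrite stepE // /psi_inv (negPf xs) (negPf (refl_neq xs)) weight_refl //.
rewrite cartan_diag reflK.
have -> : weight x s - weight x s * 2 = - weight x s by ring.
rewrite oppr_le0; case: (ltgtP (weight x s) 0) => ws.
- move: (defect s x) (defect s (refl s x)) (g x) (g (refl s x)) (g _) => a b c d e.
  by field.
- move: (defect s x) (defect s (refl s x)) (g x) (g (refl s x)) (g _) => a b c d e.
  by field.
by move: (defect s x) (g x) (g _) => a c e; field.
Qed.

Lemma psi0 s f : psi 0 s f = step s f.
Proof. by apply/funext => x; rewrite /psi mul0r mulr0 addr0. Qed.

(** * Specialization at zero and left divisors *)

Definition psis (z : rat) (l : seq I) (f : real_root -> rat) : real_root -> rat :=
  foldl (fun h s => psi z s h) f l.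

Definition steps (l : seq I) (f : real_root -> rat) : real_root -> rat :=
  foldl (fun h s => step s h) f l.

Lemma psis0 l f : psis 0 l f = steps l f.
Proof. by elim: l f => //= s l IH f; rewrite IH psi0. Qed.

Definition polynomial_family (F : rat -> real_root -> rat) :=
  forall x, exists p : {poly rat}, forall z, F z x = p.[z].

Lemma psi_polynomial s F : polynomial_family F ->
  polynomial_family (fun z => psi z s (F z)).
Proof.
move=> FP x; have [p pE] := FP x; have [p' pE'] := FP (refl s x).
have [r rE] := FP (simple_root s); rewrite /psi /step.
case: (x == _); last case: (weight x s < 0).
- exists ((defect s x)%:P * ('X * r)) => z.
  by rewrite rE add0r !hornerM hornerC hornerX.
- exists ((3 / 4)%:P * p + (1 / 4)%:P * p' + (defect s x)%:P * ('X * r)) => z.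
  by rewrite pE pE' rE 2!hornerD !hornerM !hornerC hornerX.
exists (p' + (defect s x)%:P * ('X * r)) => z.
by rewrite pE' rE hornerD !hornerM hornerC hornerX.
Qed.

Lemma psis_polynomial l F : polynomial_family F ->
  polynomial_family (fun z => psis z l (F z)).
Proof. by elim: l F => // s l IH F FP; apply/IH/psi_polynomial. Qed.

Lemma poly_eq0_nonzero (p : {poly rat}) : (forall z, z != 0 -> p.[z] = 0) -> p = 0.
Proof.
move=> p0; apply/eqP; apply: contraT => pn0.
have := @max_poly_roots _ p [seq k.+1%:R | k <- iota 0 (size p)] pn0.
rewrite size_map size_iota ltnn => -> //.
  apply/allP => _ /mapP[k _ ->]; apply/rootP/p0; by rewrite pnatr_eq0.
rewrite map_inj_uniq ?iota_uniq // => k k' /eqP.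
by rewrite eqr_nat => /eqP[].
Qed.

(** For a fixed function and a fixed root both sides are polynomials in [z], and
    they agree for all [z != 0]. *)
Lemma steps_of_psis l l' f :
  (forall z, z != 0 -> psis z l f = psis z l' f) -> steps l f = steps l' f.
Proof.
move=> ll'; apply/funext => x.
have cf : polynomial_family (fun _ => f).
  by move=> w; exists (f w)%:P => z; rewrite hornerC.
have [p pE] := psis_polynomial l cf x; have [r rE] := psis_polynomial l' cf x.
rewrite -!psis0 pE rE; congr horner.
apply/eqP; rewrite -subr_eq0; apply/eqP/poly_eq0_nonzero => z z0.
by rewrite hornerD hornerN -pE -rE ll' // subrr.
Qed.

Lemma step_ge0 s f x : (forall w, 0 <= f w) -> 0 <= step s f x.
Proof.
move=> f0; rewrite /step; move: (f0 x) (f0 (refl s x)).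
case: (x == _); first by move=> _ _; exact: lexx.
by case: (weight x s < 0); move: (f x) (f _) => a b; lra.
Qed.

Lemma steps_ge0 l f x : (forall w, 0 <= f w) -> 0 <= steps l f x.
Proof. by elim: l f => //= s l IH f f0; apply: IH => w; apply: step_ge0. Qed.

Lemma steps_linear l a b f g x :
  steps l (fun w => a * f w + b * g w) x = a * steps l f x + b * steps l g x.
Proof.
elim: l f g x => //= s l IH f g x; rewrite -IH; congr (steps l _ x).
by apply/funext => w; rewrite step_linear.
Qed.

Definition delta (x w : real_root) : rat := if w == x then 1 else 0.

(** For a word [l] and the simple root [x] of [s] this is the criterion for [s]
    to divide [l] on the left: the coefficient of [x] in the image of every root
    under the operator of [l] is zero. *)
Definition vanishes (l : seq I) (x : real_root) := forall w, steps l (delta x) w = 0.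

(** The roots [y] at which [step s (delta x)] is positive.  No cancellation
    occurs between nonnegative functions, so a word that annihilates [delta x]
    must, after its first letter, annihilate all of them. *)
Definition pull (s : I) (x y : real_root) :=
  (x != simple_root s) && ((y == refl s x) || ((y == x) && (weight x s <= 0))).

Lemma delta_diag x : delta x x = 1.
Proof. by rewrite /delta eqxx. Qed.

Lemma delta_neq x w : w != x -> delta x w = 0.
Proof. by rewrite /delta => /negPf ->. Qed.

Lemma delta_ge0 x w : 0 <= delta x w.
Proof. by rewrite /delta; case: eqP. Qed.

Lemma step_delta_pull s x y : pull s x y -> 1 / 4 <= step s (delta x) y.
Proof.
move=> /andP[xs /orP[/eqP ->|/andP[/eqP -> ws]]].
  rewrite (stepE _ (refl_neq xs)) reflK delta_diag.
  move: (delta_ge0 x (refl s x)); move: (delta _ _) => c.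
  by case: ifP => _; lra.
rewrite (stepE _ xs) delta_diag.
move: (delta_ge0 x (refl s x)) (@delta_diag x).
case: ltP => ws'; first by move: (delta _ (refl _ _)) => c; lra.
have -> : refl s x = x by apply/refl_fix/eqP; rewrite eq_le ws.
by move=> _ ->; lra.
Qed.

Lemma vanishes_pull s l x y : vanishes (s :: l) x -> pull s x y -> vanishes l y.
Proof.
move=> dx /step_delta_pull xy w.
pose r v := step s (delta x) v - 1 / 4 * delta y v.
have r0 v : 0 <= r v.
  rewrite /r; case: (eqVneq v y) => [->|vy].
    by rewrite delta_diag mulr1 subr_ge0.
  by rewrite (delta_neq vy) mulr0 subr0; apply: step_ge0 => ?; apply: delta_ge0.
have := dx w; rewrite /=.
rewrite [step s (delta x)](_ : _ = fun v => 1 * r v + 1 / 4 * delta y v).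
  rewrite steps_linear; have := steps_ge0 l w r0.
  have := steps_ge0 l w (delta_ge0 y).
  by move: (steps l _ w) (steps l _ w) => a b; lra.
by apply/funext => v; rewrite /r mul1r subrK.
Qed.

Lemma vanishes_nil x : ~ vanishes [::] x.
Proof. by move=> /(_ x) /eqP; rewrite /= delta_diag oner_eq0. Qed.

Lemma vanishes_simple s l : vanishes (s :: l) (simple_root s).
Proof.
move=> w; rewrite /= [step s _](_ : _ = fun v => 0 * 0 + 0 * 0).
  by rewrite (steps_linear l 0 0 (fun=> 0) (fun=> 0)) !mul0r addr0.
apply/funext => v; rewrite /step; case: eqP => [_|/eqP vs].
  by rewrite !mul0r addr0.
rewrite !delta_neq ?refl_neq //.
by case: ifP => _; rewrite ?mulr0 ?mul0r ?addr0.
Qed.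

Fixpoint pulls (l : seq I) (x y : real_root) : Prop :=
  if l is s :: l' then exists2 w, pull s x w & pulls l' w y else x = y.

Lemma pulls_cat l l' x y w : pulls l x y -> pulls l' y w -> pulls (l ++ l') x w.
Proof.
elim: l x => /= [x -> //|s l IH x [v xv vy] yw].
by exists v => //; apply: IH.
Qed.

Lemma vanishes_pulls l l' x y : vanishes (l ++ l') x -> pulls l x y -> vanishes l' y.
Proof.
elim: l x => /= [x ? <- //|s l IH x d [v xv vy]].
exact: IH (vanishes_pull d xv) vy.
Qed.

Lemma weight_neq s (x : real_root) : weight x s != 2 -> x != simple_root s.
Proof. by apply: contraNneq => ->; rewrite weight_simple cartan_diag. Qed.

Lemma pulls_stay l (x : real_root) :
  (forall s, s \in l -> weight x s <= 0) -> pulls l x x.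
Proof.
elim: l => //= s l IH xl.
have ws : weight x s <= 0 by rewrite xl ?mem_head.
exists x; last by apply: IH => r rl; rewrite xl // inE rl orbT.
by rewrite /pull eqxx ws orbT andbT weight_neq //; lia.
Qed.

Lemma pulls_move l s l' (x : real_root) :
  (forall r, r \in l -> weight x r <= 0) -> weight x s != 2 ->
  (forall r, r \in l' -> weight (refl s x) r <= 0) -> pulls (l ++ s :: l') x (refl s x).
Proof.
move=> xl ws xl'; apply: pulls_cat (pulls_stay xl) _.
exists (refl s x); last exact: pulls_stay.
by rewrite /pull weight_neq // eqxx.
Qed.

(** Nodes [e 0, ..., e (q - 1)] forming a path; [path_root a k] is the sum of the
    simple roots of [e a, ..., e (a + k)]. *)
Section Path.
Variables (q : nat) (e : nat -> I).
Hypothesis e_inj : forall p p', (p < q)%N -> (p' < q)%N -> e p = e p' -> p = p'.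
Hypothesis e_adj : forall p p', (p < q)%N -> (p' < q)%N ->
  adj (e p) (e p') = (p == p'.+1) || (p' == p.+1).

Fixpoint path_root (a k : nat) : real_root :=
  if k is k'.+1 then refl (e (a + k)) (path_root a k') else simple_root (e a).

Definition path_weight (a b p : nat) : int :=
  (p == a)%:Z + (p == b)%:Z - (p.+1 == a)%:Z - (p == b.+1)%:Z.

Lemma cartan_path p p' : (p < q)%N -> (p' < q)%N ->
  cartan (e p) (e p') = if p == p' then 2 else
    if (p == p'.+1) || (p' == p.+1) then -1 else 0.
Proof.
move=> pq pq'; rewrite /cartan e_adj //; case: (eqVneq p p') => [->|pp].
  by rewrite eqxx.
by case: eqP => // /(e_inj pq pq') e0; rewrite e0 eqxx in pp.
Qed.

Lemma path_root_weightE a k p : (a + k < q)%N -> (p < q)%N ->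
  weight (path_root a k) (e p) = path_weight a (a + k) p.
Proof.
elim: k p => [|k IH] p akq pq.
  rewrite addn0 weight_simple cartan_path //; last by lia.
  by rewrite /path_weight; do ![case: eqP => ?] => //=; lia.
have w1 := IH (a + k.+1)%N; rewrite /path_weight in w1.
have {}w1 : weight (path_root a k) (e (a + k.+1)) = -1.
  by rewrite w1; [do ![case: eqP => ?] => //=; lia|lia..].
rewrite /= weight_refl ?weight_neq ?w1 // IH //; last by lia.
rewrite cartan_path //.
by rewrite /path_weight; do ![case: eqP => ?] => //=; lia.
Qed.

Lemma path_root_weight_off a k v : (a + k < q)%N ->
  (forall p, (p < q)%N -> (e p != v) && ~~ adj (e p) v) ->
  weight (path_root a k) v = 0.
Proof.
move=> akq ev; have cv p : (p < q)%N -> cartan (e p) v = 0.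
  by move=> /ev/andP[n1 n2]; rewrite cartan_far.
elim: k akq => [|k IH] akq; first by rewrite weight_simple cv //; lia.
rewrite /= weight_refl; first by rewrite IH ?cv; [rewrite mulr0 subr0|lia..].
rewrite weight_neq // path_root_weightE /path_weight; [|lia..].
by do ![case: eqP => ?] => //=; lia.
Qed.

Lemma path_root_shrinkr a k : refl (e (a + k.+1)) (path_root a k.+1) = path_root a k.
Proof. by rewrite /= reflK. Qed.

Lemma path_root_shrinkl a k : (a + k.+1 < q)%N ->
  refl (e a) (path_root a k.+1) = path_root a.+1 k.
Proof.
elim: k => [|k IH] akq.
  by rewrite /= addn1 refl_simple_adj ?reflK // e_adj; lia.
rewrite [path_root a k.+2]/= refl_comm; last 2 first.
- by apply/eqP => /e_inj; lia.
- by rewrite e_adj; lia.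
by rewrite IH; [rewrite /= addnS addSn|lia].
Qed.
End Path.
End Roots.

Local Close Scope ring_scope.

(** * Alternating products along a path *)

(** Two interleaved copies of a path with [q] nodes: [g l p] is the node at
    position [p] with colour [l], and it is braided with the nodes of the other
    colour at positions [p - 1] and [p + 1] only.  An alternating product of
    length [q + 1] is a grid, whose row [t] is a [run] of one colour. *)
Section BraidProducts.
Local Open Scope group_scope.
Variable H : groupType.

Fixpoint altprod (x y : H) (k : nat) : H :=
  if k is k'.+1 then x * altprod y x k' else 1.

Lemma commute_altprod (u x y : H) k :
  commute u x -> commute u y -> commute u (altprod x y k).
Proof.
elim: k x y => [|k IH] x y ux uy; first exact: commute1.
by apply: commuteM => //; apply: IH.
Qed.

Lemma altprodM (x y x' y' : H) k :
    commute x' x -> commute x' y -> commute y' x -> commute y' y ->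
  altprod (x * x') (y * y') k = altprod x y k * altprod x' y' k.
Proof.
elim: k x y x' y' => [|k IH] x y x' y' xx xy yx yy; first by rewrite mulg1.
rewrite /= IH // -!mulgA; congr (_ * _); rewrite !mulgA; congr (_ * _).
exact: commute_altprod.
Qed.

Variables (q : nat) (g : bool -> nat -> H).
Hypothesis g_comm : forall l l' p p', p < q -> p' < q ->
  (l == l') || ((p != p'.+1) && (p' != p.+1)) -> commute (g l p) (g l' p').
Hypothesis g_braid : forall l p, p.+1 < q ->
  g l p * g (~~ l) p.+1 * g l p = g (~~ l) p.+1 * g l p * g (~~ l) p.+1.

Definition run l a b := \prod_(a <= p < b) g l p.
Definition pairs a b := \prod_(a <= p < b) (g true p * g false p).

(** The part of the grid on or above a diagonal, and the part below it. *)
Fixpoint upper b l t n : H :=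
  if n is n'.+1 then run l t b * upper b (~~ l) t.+1 n' else 1.
Fixpoint lower l t n : H :=
  if n is n'.+1 then run l 0 t * lower (~~ l) t.+1 n' else 1.

Lemma commute_run u l a b : (forall p, a <= p < b -> commute u (g l p)) ->
  commute u (run l a b).
Proof.
move=> up; rewrite /run big_nat_cond.
by apply: (big_rec (commute u)) => [|p x /andP[/up ug _] ux];
  [exact: commute1|exact: commuteM].
Qed.

Lemma commute_pairs u a b :
  (forall l p, a <= p < b -> commute u (g l p)) -> commute u (pairs a b).
Proof.
move=> up; rewrite /pairs big_nat_cond.
apply: (big_rec (commute u)) => [|p x /andP[pab _] ux]; first exact: commute1.
by apply: commuteM => //; apply: commuteM; apply: up.
Qed.

Lemma commute_upper u b l t n :
  (forall l p, t <= p < b -> commute u (g l p)) -> commute u (upper b l t n).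
Proof.
elim: n l t => [|n IH] l t up; first exact: commute1.
apply: commuteM; first by apply: commute_run => p; apply: up.
by apply: IH => l' p pb; apply: up; lia.
Qed.

Lemma run_recl l a b : a < b -> run l a b = g l a * run l a.+1 b.
Proof. exact: big_ltn. Qed.

Lemma pairs_recl l a b : a < b -> b <= q ->
  pairs a b = g l a * g (~~ l) a * pairs a.+1 b.
Proof.
move=> ab bq; rewrite /pairs big_ltn //; congr (_ * _).
by case: l => //=; apply: g_comm; lia.
Qed.

(** Entries below the diagonal commute with all later entries above it, as their
    positions differ by at least two. *)
Lemma altprod_split b l t n : b <= q -> t + n <= b.+1 ->
  altprod (run l 0 b) (run (~~ l) 0 b) n = upper b l t n * lower l t n.
Proof.
move=> bq; elim: n l t => [|n IH] l t tn /=; first by rewrite mulg1.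
have runE : run l 0 b = run l t b * run l 0 t.
  rewrite {1}/run (@big_cat_nat _ _ _ t) /=; try lia.
  apply/commute_sym/commute_run => p pb.
  apply/commute_sym/commute_run => p' pb'.
  by apply: g_comm; lia.
have := IH (~~ l) t.+1; rewrite negbK => -> //; last by lia.
rewrite runE -!mulgA; congr (_ * _); rewrite !mulgA; congr (_ * _).
apply/commute_upper => l' p pb; apply/commute_sym/commute_run => p' pb'.
by apply: g_comm; lia.
Qed.

(** A node passes through a product of Coxeter type to the next position, with
    the other colour. *)
Lemma shift_pairs l a p : a < p -> p < q ->
  g l p * pairs a q = pairs a q * g (~~ l) p.-1.
Proof.
move=> ap pq; have [n] : exists n, p = (a + n).+1 by exists (p - a).-1; lia.
elim: n a {ap} => [|n IH] a pE; last first.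
  rewrite (pairs_recl l) //; [|lia..].
  rewrite !mulgA -[in RHS]mulgA -IH; last by lia.
  rewrite !mulgA; congr (_ * _).
  have c1 : commute (g l p) (g l a) by apply: g_comm; lia.
  have c2 : commute (g l p) (g (~~ l) a) by apply: g_comm; lia.
  by rewrite c1 -!mulgA c2.
rewrite addn0 in pE; rewrite pE /=.
rewrite (pairs_recl l) ?(pairs_recl l (a := a.+1)) //; [|lia..].
have c1 : commute (g l a.+1) (g l a) by apply: g_comm; lia.
have c2 : commute (g (~~ l) a) (g (~~ l) a.+1) by apply: g_comm; lia.
have c3 : commute (g (~~ l) a) (pairs a.+2 q).
  by apply: commute_pairs => l' p' pb; apply: g_comm; lia.
have br : g (~~ l) a * g l a.+1 * g (~~ l) a = g l a.+1 * g (~~ l) a * g l a.+1.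
  by have := g_braid (~~ l) (p := a); rewrite negbK; apply; lia.
rewrite !mulgA c1 -!mulgA; congr (_ * _).
rewrite -c3 !mulgA; congr (_ * _).
by rewrite -br -!mulgA c2.
Qed.

(** The two diagonals in the upper part of the grid form [pairs]; moving them to
    the front shifts the remaining entries by one position and leaves the upper
    part of the grid for the path with one node less. *)
Lemma upper_peel l r n : r + n = q ->
  run l r q * upper q (~~ l) r n = pairs r q * upper q.-1 (~~ l) r n.
Proof.
elim: n l r => [|n IH] l r rn.
  by rewrite /run /pairs !big_geq; [|lia..].
have rq : r < q by lia.
rewrite /= negbK {1}run_recl // [run (~~ l) r q]run_recl // -!mulgA.
have := IH (~~ l) r.+1; rewrite negbK => ->; last by lia.
rewrite (pairs_recl l (a := r)) // -!mulgA; congr (_ * _).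
rewrite !mulgA; congr (_ * _).
have shift p : r < p < q -> g l p * (g (~~ l) r * pairs r.+1 q)
    = g (~~ l) r * pairs r.+1 q * g (~~ l) p.-1.
  move=> /andP[rp pq]; case: (ltnP r.+1 p) => rp1.
    have c : commute (g l p) (g (~~ l) r) by apply: g_comm; lia.
    by rewrite mulgA c -mulgA (shift_pairs l rp1 pq) mulgA.
  have -> : p = r.+1 by lia.
  have br : g (~~ l) r * g l r.+1 * g (~~ l) r = g l r.+1 * g (~~ l) r * g l r.+1.
    by have := g_braid (~~ l) (p := r); rewrite negbK; apply; lia.
  have c2 : commute (g (~~ l) r) (g (~~ l) r.+1) by apply: g_comm; lia.
  have c3 : commute (g (~~ l) r) (pairs r.+2 q).
    by apply: commute_pairs => l' p' pb; apply: g_comm; lia.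
  rewrite (pairs_recl l) //; last by lia.
  rewrite /= -[RHS]mulgA -[in RHS]mulgA -[in RHS]mulgA -c3 !mulgA -br.
  by rewrite -!mulgA (mulgA (g (~~ l) r) (g (~~ l) r.+1)) c2 -!mulgA.
have runs b : r < b -> b <= q ->
    run l r.+1 b * (g (~~ l) r * pairs r.+1 q)
    = g (~~ l) r * pairs r.+1 q * run (~~ l) r b.-1.
  elim: b => // b IHb rb bq; case: (ltnP r b) => rb'; last first.
    by rewrite /run !big_geq ?mulg1 ?mul1g //; lia.
  rewrite /run big_nat_recr //= -mulgA shift; last by lia.
  rewrite mulgA -/(run l r.+1 b) IHb //; last by lia.
  rewrite -mulgA; congr (_ * _).
  by case: b rb' {rb bq IHb} => // b rb'; rewrite /run big_nat_recr.
by rewrite -[LHS]mulgA runs.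
Qed.
End BraidProducts.

(** Induction on [q]: after peeling [pairs], which does not depend on the colour
    of the first row, the grid of the shorter path starting with the other colour
    remains. *)
Lemma path_braid (H : groupType) q (g : bool -> nat -> H) l :
    (forall l l' p p', p < q -> p' < q ->
      (l == l') || ((p != p'.+1) && (p' != p.+1)) -> commute (g l p) (g l' p')) ->
    (forall l p, p.+1 < q ->
      g l p * g (~~ l) p.+1 * g l p = g (~~ l) p.+1 * g l p * g (~~ l) p.+1)%g ->
  altprod (run g l 0 q) (run g (~~ l) 0 q) q.+1
  = altprod (run g (~~ l) 0 q) (run g l 0 q) q.+1.
Proof.
elim: q l => [|q IH] l gC gB.
  by rewrite /= /run !big_geq.
have peel m : altprod (run g m 0 q.+1) (run g (~~ m) 0 q.+1) q.+2
    = (pairs g 0 q.+1 * altprod (run g (~~ m) 0 q) (run g m 0 q) q.+1)%g.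
  have := altprod_split (g := g) (q := q.+1) gC (b := q) (~~ m) (t := 0) (n := q.+1).
  rewrite negbK => -> //.
  rewrite mulgA -(upper_peel gC gB m (r := 0)) //.
  have := altprod_split (g := g) (q := q.+1) gC (b := q.+1) (~~ m) (t := 0) (n := q.+1).
  by rewrite negbK => e; rewrite -[RHS]mulgA -e.
have := peel (~~ l); rewrite negbK => ->; rewrite peel; congr (_ * _)%g.
by apply/esym/IH => [k k' p p' pq pq'|k p pq]; [apply: gC; lia|apply: gB; lia].
Qed.

(** * Bijections as targets of presented groups *)

Local Open Scope ring_scope.

(** The product is composition from left to right, so that words act in the
    order in which they are read. *)
Record bijection (T : Type) := Bijection {
  bij_fun :> T -> T;
  bij_inv : T -> T;
  bij_funK : cancel bij_fun bij_inv;
  bij_invK : cancel bij_inv bij_fun }.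

HB.instance Definition _ (T : Type) := gen_eqMixin (bijection T).
HB.instance Definition _ (T : Type) := gen_choiceMixin (bijection T).

Lemma bijection_eq (T : Type) (f g : bijection T) : f =1 g -> f = g.
Proof.
case: f g => [f f' fK f'K] [g g' gK g'K] /= /funext fg; subst g.
have fg' : f' = g' by apply/funext => x; rewrite -{1}[x]g'K fK.
by subst g'; rewrite (Prop_irrelevance fK gK) (Prop_irrelevance f'K g'K).
Qed.

Section BijectionGroup.
Variable T : Type.
Implicit Types f g h : bijection T.

Definition bij_one : bijection T :=
  @Bijection T id id (fun=> erefl) (fun=> erefl).
Definition bij_inverse f : bijection T := Bijection (bij_invK f) (bij_funK f).
Definition bij_mul f g : bijection T :=
  Bijection (can_comp (bij_funK g) (bij_funK f))
            (can_comp (bij_invK f) (bij_invK g)).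

Lemma bij_mulA : associative bij_mul.
Proof. by move=> f g h; apply: bijection_eq. Qed.
Lemma bij_mul1 : left_id bij_one bij_mul.
Proof. by move=> f; apply: bijection_eq. Qed.
Lemma bij_mulr1 : right_id bij_one bij_mul.
Proof. by move=> f; apply: bijection_eq. Qed.
Lemma bij_mulV : left_inverse bij_one bij_inverse bij_mul.
Proof. by move=> f; apply: bijection_eq => x /=; rewrite bij_invK. Qed.
Lemma bij_mulrV : right_inverse bij_one bij_inverse bij_mul.
Proof. by move=> f; apply: bijection_eq => x /=; rewrite bij_funK. Qed.

HB.instance Definition _ :=
  isGroup.Build (bijection T) bij_mulA bij_mul1 bij_mulr1 bij_mulV bij_mulrV.

Lemma bij_mulE f g x : (f * g)%g x = g (f x).
Proof. by []. Qed.
End BijectionGroup.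

Section Evaluation.
Local Open Scope group_scope.
Variables (I : choiceType) (H : groupType) (gen : I -> H).

Definition eval (w : letters I) : H :=
  \prod_(l <- w) (if l.2 then gen l.1 else (gen l.1)^-1).

Lemma eval_cat u v : eval (u ++ v) = eval u * eval v.
Proof. exact: big_cat. Qed.

Lemma eval_cons l w :
  eval (l :: w) = (if l.2 then gen l.1 else (gen l.1)^-1) * eval w.
Proof. exact: big_cons. Qed.

Lemma eval_nil : eval [::] = 1.
Proof. exact: big_nil. Qed.

Lemma presented_eq_eval (R : letters I -> letters I -> Prop) u v :
    (forall u' v', R u' v' -> eval u' = eval v') ->
  presented_eq R u v -> eval u = eval v.
Proof.
move=> Rgen; elim=> {u v}
  [u v /Rgen //|x b|u u' v v' _ IHu _ IHv|//|u v _ -> //|u v w _ -> _ -> //].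
- rewrite !eval_cons !eval_nil mulg1 /=.
  by case: b => /=; rewrite ?mulgV ?mulVg.
- by rewrite !eval_cat IHu IHv.
Qed.
End Evaluation.

(** * Folding and the embedding of the Artin monoid *)

Definition positive (I : choiceType) (w : seq I) : letters I :=
  [seq (i, true) | i <- w].

(** Here [L] replaces infinite labels. *)
Section Folding.
Variables (n : nat) (M : coxeter_matrix n) (L : nat).
Hypothesis L_ge2 : (2 <= L)%N.

Definition label (i j : 'I_n) : nat := odflt L (M i j).

Lemma label_sym i j : label i j = label j i.
Proof. by rewrite /label cox_sym. Qed.

Lemma label_ge2 i j : i != j -> (2 <= label i j)%N.
Proof.
move=> ij; rewrite /label; case E : (M i j) => [k|] //=.
exact: cox_off_diag ij E.
Qed.

Definition node := ('I_n * nat)%type.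

(** Over two generators with label [k], consecutive positions are joined unless
    they are separated by a multiple of [k - 1]: the positions are cut into blocks
    of length [k - 1], and the nodes over a block form two paths, according to
    the generator over which its first position lies. *)
Definition node_adj (u v : node) : bool :=
  (u.1 != v.1) &&
  (((v.2 == u.2.+1) && ~~ ((label u.1 v.1).-1 %| v.2)) ||
   ((u.2 == v.2.+1) && ~~ ((label u.1 v.1).-1 %| u.2)))%N.

Lemma node_adj_sym : symmetric node_adj.
Proof. by move=> u v; rewrite /node_adj eq_sym orbC label_sym. Qed.

Lemma node_adj_irr : irreflexive node_adj.
Proof. by move=> u; rewrite /node_adj eqxx. Qed.

(** A common multiple of all block lengths. *)
Definition width : nat :=
  \prod_(ij : 'I_n * 'I_n | ij.1 != ij.2) (label ij.1 ij.2).-1.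

Lemma width_gt0 : (0 < width)%N.
Proof. by apply: prodn_cond_gt0 => -[i j] /= /label_ge2; lia. Qed.

Lemma dvdn_width i j : i != j -> ((label i j).-1 %| width)%N.
Proof. by move=> ij; rewrite /width (bigD1 (i, j)) //= dvdn_mulr. Qed.

Definition fiber (i : 'I_n) : seq node := [seq (i, z) | z <- iota 0 width].

Definition unfold (w : seq 'I_n) : seq node := flatten [seq fiber i | i <- w].

Notation nroot := (real_root node_adj).
Notation npsis := (psis node_adj_sym node_adj_irr).
Notation nvanishes := (@vanishes _ _ node_adj_sym node_adj_irr).
Notation nsimple := (simple_root node_adj).

Section Bijections.
Variables (z : rat) (z_neq0 : z != 0).
Local Open Scope group_scope.

Definition psi_bij (s : node) : bijection (nroot -> rat) :=
  Bijection (psiK node_adj_sym node_adj_irr s z_neq0)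
    (psi_invK node_adj_sym node_adj_irr s z_neq0).

Lemma prod_psi_bij l f : (\prod_(s <- l) psi_bij s : bijection _) f = npsis z l f.
Proof. by elim: l f => [|s l IH] f; rewrite ?big_nil ?big_cons //= IH. Qed.

Lemma psi_bij_comm s t : ~~ node_adj s t -> commute (psi_bij s) (psi_bij t).
Proof.
move=> nst; case: (eqVneq s t) => [->|st]; first exact: commute_refl.
by apply: bijection_eq => f /=; rewrite psi_comm // 1?node_adj_sym // eq_sym.
Qed.

Lemma psi_bij_braid s t : node_adj s t ->
  psi_bij s * psi_bij t * psi_bij s = psi_bij t * psi_bij s * psi_bij t.
Proof. by move=> st; apply: bijection_eq => f /=; rewrite psi_braid. Qed.

Definition fiber_bij (i : 'I_n) : bijection (nroot -> rat) :=
  \prod_(s <- fiber i) psi_bij s.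

(** The blocks commute with each other, and each one contributes a relation
    [path_braid]. *)
Lemma alternating_fiber_bij i j k : i != j -> M i j = Some k ->
  altprod (fiber_bij i) (fiber_bij j) k = altprod (fiber_bij j) (fiber_bij i) k.
Proof.
move=> ij Mk; have lk : label i j = k by rewrite /label Mk.
have k2 : (2 <= k)%N by rewrite -lk label_ge2.
case: k => [|q] // in Mk lk k2 *.
pose g (l : bool) p := psi_bij (if l then i else j, p).
have runE l : fiber_bij (if l then i else j) = run g l 0 width.
  by rewrite /fiber_bij /fiber big_map /run /index_iota subn0.
have [B BE] : exists B, width = (B * q)%N.
  by have /dvdnP := dvdn_width ij; rewrite lk.
rewrite (runE true) (runE false) BE.
have gC l l' p p' : (l == l') || (p != p'.+1) && (p' != p.+1)
    -> commute (g l p) (g l' p').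
  move=> h; apply: psi_bij_comm; rewrite /node_adj /=.
  by case: l l' h => [] [] //=; rewrite ?eqxx // => /andP[/negPf -> /negPf ->];
     rewrite andbF.
elim: B {BE} => [|B IH]; first by rewrite /run !big_geq.
have blocks l : run g l 0 (B.+1 * q)
    = run g l 0 (B * q) * run (fun l' p => g l' (p + B * q)%N) l 0 q.
  rewrite /run (@big_cat_nat _ _ _ (B * q)) ?leq_mul2r ?leqnSn ?orbT //=.
  congr (_ * _); rewrite -{1}[(B * _)%N]add0n big_addn.
  by congr (bigop.body _ _ _); congr index_iota; lia.
have cross l l' : commute (run (fun m p => g m (p + B * q)%N) l 0 q)
    (run g l' 0 (B * q)).
  apply: commute_run => p pB; apply/commute_sym/commute_run => p' pk.
  apply: psi_bij_comm; rewrite /node_adj /= !negb_and !negb_or.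
  case: (eqVneq p (p' + B * q).+1) => [|_] /=; first by lia.
  case: (eqVneq (p' + B * q)%N p.+1) => [pE|_] /=; last by rewrite !orbT.
  have p'0 : p' = 0%N by lia.
  rewrite pE -pE p'0 add0n andbT; apply/orP.
  case: l l' => [] []; rewrite ?eqxx ?negbK; try by left.
    by right; rewrite label_sym lk dvdn_mull.
  by right; rewrite lk dvdn_mull.
rewrite !blocks !altprodM // IH; congr (_ * _).
apply: (path_braid (q := q) true) => [l l' p p' pk pk' h|l p pk].
  by apply: gC; move: h; case: (l == l') => //=; lia.
apply: psi_bij_braid; rewrite /node_adj /=.
have nd : ~~ (q %| (p.+1 + B * q))%N.
  by rewrite dvdn_addl ?dvdn_mull // gtnNdvd.
case: l => /=; rewrite -addSn eqxx ?lk; first by rewrite ij nd.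
by rewrite eq_sym ij label_sym lk nd.
Qed.

Lemma eval_alternating (i j : 'I_n) k :
  eval fiber_bij (alternating i j k) = altprod (fiber_bij i) (fiber_bij j) k.
Proof.
by elim: k i j => [|k IH] i j; rewrite ?eval_nil // eval_cons IH.
Qed.

Lemma eval_positive w f :
  (eval fiber_bij (positive w) : bijection _) f = npsis z (unfold w) f.
Proof.
elim: w f => [|i w IH] f; first by rewrite eval_nil.
rewrite eval_cons bij_mulE IH /= prod_psi_bij /unfold /=.
by rewrite /psis foldl_cat.
Qed.
End Bijections.

Lemma steps_presented_eq u v f :
  presented_eq (artin_rel M) (positive u) (positive v) ->
  steps node_adj_sym node_adj_irr (unfold u) f
  = steps node_adj_sym node_adj_irr (unfold v) f.
Proof.
move=> uv; apply: steps_of_psis => z z0; rewrite -!(eval_positive z0).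
congr (bij_fun _ _); apply: presented_eq_eval uv => _ _ [i j k ij Mk].
rewrite !eval_alternating; exact: alternating_fiber_bij.
Qed.

(** The ends of a segment that starts as one node, at position [start], and is
    transformed by letters of alternating colours.  The left end moves to the
    left during [tl] letters, rests once, and then moves to the right; the right
    end does the opposite with [tr].  The ends meet again after
    [(tl + tr).+1] letters.  Any number of letters smaller than the label can be
    obtained in this way without leaving the path. *)
Definition left_end (start tl t : nat) : nat :=
  if (t <= tl)%N then (start - t)%N else (start + t - 1 - tl.*2)%N.

Definition right_end (start tr t : nat) : nat :=
  if (t <= tr)%N then (start + t)%N else (start + tr.*2 + 1 - t)%N.

Lemma bounce_step q start tl tr t : (tl <= start)%N -> (start + tr < q)%N ->
    (t <= tl + tr)%N ->
  let a := left_end start tl t in let a1 := left_end start tl t.+1 in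
  let b := right_end start tr t in let b1 := right_end start tr t.+1 in
  [/\ (a + (b - a) < q)%N, (a1 + (b - a1) < q)%N, (a <= a1 + (b - a1))%N,
      (a1 <= a)%N || (odd (a1 + start) != ~~ odd t)
    & [\/ [/\ odd (a + start) = ~~ odd t, a1 = a.+1 & (b - a = (b - a1).+1)%N],
          [/\ odd (a + start) != ~~ odd t, a = a1.+1 & (b - a1 = (b - a).+1)%N]
        | [/\ odd (a + start) != ~~ odd t, a1 = a & (b - a1 = b - a)%N]]
    /\ [\/ [/\ odd (a1 + (b - a1) + start) = ~~ odd t,
               (b - a1 = (b1 - a1).+1)%N & (a < a1 + (b - a1))%N],
          [/\ odd (a1 + (b - a1) + start) != ~~ odd t,
               (b1 - a1 = (b - a1).+1)%N & ((a1 + (b - a1)).+1 < q)%N]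
        | odd (a1 + (b - a1) + start) != ~~ odd t /\ (b1 - a1 = b - a1)%N]].
Proof.
rewrite /left_end /right_end => tl_le tr_le t_le.
case: (ltngtP t tl) => ttl; case: (ltngtP t tr) => ttr;
  rewrite ?ttl ?ttr ?ltnn ?leqnn ?(ltnW ttl) ?(ltnW ttr); split; try lia; split;
  first [by apply: Or31; split; lia | by apply: Or32; split; lia
        | by apply: Or33; split; lia].
Qed.

Lemma bounce_end start tl tr : (tl <= start)%N ->
  left_end start tl (tl + tr).+1 = (start + tr - tl)%N
  /\ right_end start tr (tl + tr).+1 = left_end start tl (tl + tr).+1.
Proof. by rewrite /left_end /right_end => tl_le; split; do ![case: leqP => ?]; lia. Qed.

Fixpoint altword (T : Type) (x y : T) (k : nat) : seq T :=
  if k is k'.+1 then x :: altword y x k' else [::].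

(** The path through the node [(i, z)] in its block for the pair [i, j];
    [letter true] is [j] and the node at position [start] is [(i, z)]. *)
Section Travel.
Variables (i j : 'I_n) (z : nat).
Hypotheses (ij : i != j) (z_lt : (z < width)%N).

Let q : nat := (label i j).-1.
Let base : nat := (z %/ q * q)%N.
Let start : nat := (z %% q)%N.
Let letter (b : bool) : 'I_n := if b then j else i.
Let path p : node := (letter (odd (p + start)), (base + p)%N).
Notation refl := (refl node_adj_sym node_adj_irr).
Notation segment := (@path_root _ _ node_adj_sym node_adj_irr path).

Let q_gt0 : (0 < q)%N.
Proof. by rewrite /q; have := label_ge2 ij; lia. Qed.

Let start_lt : (start < q)%N.
Proof. by rewrite /start ltn_mod. Qed.

Let base_le : (base + q <= width)%N.
Proof.
have /dvdnP[B BE] := dvdn_width ij; have zB := z_lt; rewrite BE -/q in zB *.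
by rewrite /base -mulSnr leq_mul2r ltn_divLR // zB orbT.
Qed.

Let base_start : (base + start)%N = z.
Proof. by rewrite /base /start -divn_eq. Qed.

Let letter_eq b b' : (letter b == letter b') = (b == b').
Proof. by case: b b' => [] [] /=; rewrite ?eqxx ?(negPf ij) // eq_sym (negPf ij). Qed.

Let label_letter b : label (letter b) (letter (~~ b)) = label i j.
Proof. by case: b => //=; rewrite label_sym. Qed.

Let dvdn_base p : (q %| base + p)%N = (q %| p)%N.
Proof. by rewrite dvdn_addr // dvdn_mull. Qed.

Let path_inj p p' : (p < q)%N -> (p' < q)%N -> path p = path p' -> p = p'.
Proof. by move=> _ _ [_ /addnI]. Qed.

Let path_letter_adj p b zz : (p < q)%N ->
  node_adj (path p) (letter b, zz)
  = [&& odd (p + start) != b, (base <= zz < base + q)%N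
      & (zz == (base + p).+1) || (base + p == zz.+1)%N].
Proof.
move=> pq; rewrite /node_adj /= letter_eq.
case: eqVneq => //= pb; have {pb}-> : b = ~~ odd (p + start).
  by move: pb; case: odd b => [] [].
rewrite label_letter -/q.
case: (eqVneq zz (base + p).+1) => [->|_] /=.
  rewrite (_ : (base + p == (base + p).+2)%N = false) ?orbF; last by lia.
  rewrite -addnS dvdn_base.
  case: (ltnP p.+1 q) => pq'; first by rewrite gtnNdvd //; lia.
  by rewrite (_ : p.+1 = q) ?dvdnn ?ltnn ?andbF //; lia.
case: (eqVneq (base + p)%N zz.+1) => [E|_] /=; last by rewrite andbF.
rewrite -E dvdn_base; case: p pq E => [|p] pq E; first by rewrite dvdn0 /=; lia.
by rewrite gtnNdvd //; lia.
Qed.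

Let path_adj p p' : (p < q)%N -> (p' < q)%N ->
  node_adj (path p) (path p') = (p == p'.+1) || (p' == p.+1).
Proof. by move=> pq pq'; rewrite path_letter_adj //; lia. Qed.

Let weight_path a k b zz : (a + k < q)%N ->
  weight (segment a k) (letter b, zz)
  = if (base <= zz < base + q)%N && (odd (zz - base + start) == b)
    then path_weight a (a + k) (zz - base) else 0.
Proof.
move=> akq; case: ifP => [/andP[zzb /eqP <-]|zzb].
  have -> : (letter (odd (zz - base + start)), zz) = path (zz - base)%N.
    by rewrite /path subnKC //; lia.
  by apply: (path_root_weightE node_adj_sym node_adj_irr path_inj path_adj akq); lia.
apply: (path_root_weight_off node_adj_sym node_adj_irr path_inj path_adj akq) => p pq.
rewrite path_letter_adj // /path xpair_eqE letter_eq; lia.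
Qed.

Let bound (b : bool) l m : seq node := [seq (letter b, zz) | zz <- iota l m].

Let boundP b l m (P : node -> Prop) :
  (forall zz, (l <= zz < l + m)%N -> P (letter b, zz)) ->
  forall r, r \in bound b l m -> P r.
Proof. by move=> Pzz r /mapP[zz]; rewrite mem_iota => /Pzz Pz ->. Qed.

Let pulls_bound b l m a k x y : (l <= base + x < l + m)%N -> (x < q)%N ->
    odd (x + start) == b ->
    refl (path x) (segment a k) = y ->
    weight (segment a k) (path x) != 2 ->
    (forall zz, (l <= zz < base + x)%N -> weight (segment a k) (letter b, zz) <= 0) ->
    (forall zz, (base + x < zz < l + m)%N -> weight y (letter b, zz) <= 0) ->
  pulls node_adj_sym node_adj_irr (bound b l m) (segment a k) y.
Proof.
move=> lx xq xb <- w2 w w'.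
have -> : bound b l m = bound b l (base + x - l) ++ path x ::
    bound b (base + x).+1 (l + m - (base + x).+1).
  rewrite /path (eqP xb) /bound -[_ :: _]/(map _ ((base + x)%N :: iota _ _)).
  rewrite -map_cat -[_ :: iota _ _]/(iota _ (_.+1)).
  rewrite -[in iota (base + x)](@subnKC l (base + x)) ?iotaD -1?iotaD; last by lia.
  by congr map; congr iota; lia.
apply: pulls_move => //; apply: boundP => zz zzb; [apply: w|apply: w']; lia.
Qed.

Let weight_le0 a k b zz : (a + k < q)%N ->
    ((base <= zz < base + q)%N -> odd (zz - base + start) == b ->
     path_weight a (a + k) (zz - base) <= 0) ->
  weight (segment a k) (letter b, zz) <= 0.
Proof.
by move=> akq h; rewrite weight_path //; case: ifP => // /andP[zb /h ->].
Qed.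

Let weight_at a k x : (a + k < q)%N -> (x < q)%N ->
  weight (segment a k) (path x) = path_weight a (a + k) x.
Proof. exact: (path_root_weightE node_adj_sym node_adj_irr path_inj path_adj). Qed.

Let shrinkl a k : (a + k.+1 < q)%N ->
  refl (path a) (segment a k.+1) = segment a.+1 k.
Proof. exact: (path_root_shrinkl node_adj_sym node_adj_irr path_inj path_adj). Qed.

Let pulls_bound_stay b l m a k :
    (forall zz, (l <= zz < l + m)%N -> weight (segment a k) (letter b, zz) <= 0) ->
  pulls node_adj_sym node_adj_irr (bound b l m) (segment a k) (segment a k).
Proof. by move=> h; apply: pulls_stay; apply: boundP. Qed.

Let pulls_left b a k a' k' : (a + k < q)%N -> 
    [\/ [/\ odd (a + start) = b, a' = a.+1 & k = k'.+1],
        [/\ odd (a + start) != b, a = a'.+1 & k' = k.+1]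
      | [/\ odd (a + start) != b, a' = a & k' = k]] ->
  pulls node_adj_sym node_adj_irr (bound b 0 (base + a).+1)
    (segment a k) (segment a' k').
Proof.
move=> akq [[ab -> kE]|[ab aE ->]|[ab -> ->]].
- rewrite kE in akq *; apply: (pulls_bound (x := a)); try lia.
  + by rewrite shrinkl.
  + by rewrite weight_at /path_weight; lia.
  + move=> zz zb; apply: weight_le0 => //; rewrite /path_weight; lia.
- rewrite aE in ab akq *; apply: (pulls_bound (x := a')); try lia.
  + by rewrite -shrinkl ?reflK //; lia.
  + by rewrite weight_at /path_weight; lia.
  + move=> zz zb; apply: weight_le0 => //; rewrite /path_weight; lia.
  + move=> zz zb; apply: weight_le0; rewrite /path_weight; lia.
apply: pulls_bound_stay => zz zb; apply: weight_le0 => //.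
rewrite /path_weight; lia.
Qed.

Let pulls_right b m a k k' : (a + k < q)%N ->
    (m <= (a + k).+1)%N -> (a < m)%N || (odd (a + start) != b) ->
    [\/ [/\ odd (a + k + start) = b, k = k'.+1 & (m <= a + k)%N],
        [/\ odd (a + k + start) != b, k' = k.+1 & ((a + k).+1 < q)%N]
      | odd (a + k + start) != b /\ k' = k] ->
  pulls node_adj_sym node_adj_irr (bound b (base + m) (width - (base + m)))
    (segment a k) (segment a k').
Proof.
move=> akq mk am [[ab kE mak]|[ab -> akq']|[ab ->]].
- rewrite kE in ab akq mk mak *; apply: (pulls_bound (x := (a + k'.+1)%N)); try lia.
  + by rewrite path_root_shrinkr.
  + by rewrite weight_at /path_weight; lia.
  + move=> zz zb; apply: weight_le0 => //; rewrite /path_weight; lia.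
  + move=> zz zb; apply: weight_le0; rewrite /path_weight; lia.
- apply: (pulls_bound (x := (a + k.+1)%N)) => //; try lia.
  + by rewrite weight_at /path_weight; lia.
  + move=> zz zb; apply: weight_le0 => //; rewrite /path_weight; lia.
  + move=> zz zb; apply: weight_le0; rewrite /path_weight; lia.
apply: pulls_bound_stay => zz zb; apply: weight_le0 => //.
rewrite /path_weight; lia.
Qed.

Let pulls_round b a k a1 k1 k' : (a + k < q)%N -> (a1 + k1 < q)%N ->
    (a <= a1 + k1)%N -> (a1 <= a)%N || (odd (a1 + start) != b) ->
    [\/ [/\ odd (a + start) = b, a1 = a.+1 & k = k1.+1],
        [/\ odd (a + start) != b, a = a1.+1 & k1 = k.+1]
      | [/\ odd (a + start) != b, a1 = a & k1 = k]] ->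
    [\/ [/\ odd (a1 + k1 + start) = b, k1 = k'.+1 & (a < a1 + k1)%N],
        [/\ odd (a1 + k1 + start) != b, k' = k1.+1 & ((a1 + k1).+1 < q)%N]
      | odd (a1 + k1 + start) != b /\ k' = k1] ->
  pulls node_adj_sym node_adj_irr (fiber (letter b)) (segment a k) (segment a1 k').
Proof.
move=> akq akq1 aa aa1 left right.
have -> : fiber (letter b) = bound b 0 (base + a).+1
    ++ bound b (base + a.+1) (width - (base + a.+1)).
  rewrite /fiber /bound -map_cat addnS -{3}[(base + a).+1]add0n -iotaD.
  by congr (map _ (iota _ _)); lia.
apply: pulls_cat (pulls_left akq left) _.
by apply: pulls_right right; lia.
Qed.

(** Starting from the simple root of [(i, z)], the letters [j, i, j, ...] pull
    segments with ends [left_end] and [right_end]; after [r] letters the segment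
    is again a simple root, over the generator that comes next. *)
Lemma vanishes_travel r d : (0 < r <= (label i j).-1)%N ->
    nvanishes (unfold (altword j i r ++ d)) (nsimple (i, z)) ->
  exists2 z', (z' < width)%N
    & nvanishes (unfold d) (nsimple (if odd r then i else j, z')).
Proof.
rewrite -/q => /andP[r0 rq] dr.
have [tl [tr [tl_le tr_le rE]]] : exists tl tr,
    [/\ (tl <= start)%N, (start + tr < q)%N & r = (tl + tr).+1].
  (* The right end moves as far as possible, the left end makes up for the rest. *)
  exists (r.-1 - minn r.-1 (q.-1 - start))%N, (minn r.-1 (q.-1 - start))%N.
  by split; lia.
pose A := left_end start tl; pose B := right_end start tr.
have path_start : path start = (i, z).
  by rewrite /path base_start addnn odd_double.
have claim t : (t <= r)%N ->
    nvanishes (unfold (altword (letter (~~ odd t)) (letter (odd t)) (r - t) ++ d))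
      (segment (A t) (B t - A t)).
  elim: t => [|t IH] tr'.
    rewrite subn0 /A /B /left_end /right_end !leq0n subn0 addn0 subnn /= path_start.
    exact: dr.
  have {IH} := IH (ltnW tr'); have -> : (r - t = (r - t.+1).+1)%N by lia.
  rewrite /= negbK => dt; apply: vanishes_pulls dt _.
  have [|h1 h2 h3 h4 [hl hr]] := bounce_step tl_le tr_le (t := t); first by lia.
  exact: (pulls_round h1 h2 h3 h4 hl hr).
have := claim r (leqnn r); rewrite subnn /=.
have [Ar Br] : A r = (start + tr - tl)%N /\ B r = A r.
  by rewrite /A /B rE; exact: bounce_end.
rewrite Br subnn.
rewrite /= /path (_ : odd (A r + start) = ~~ odd r); last by rewrite Ar rE; lia.
move=> dd; exists (base + A r)%N; first by rewrite Ar; lia.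
by move: dd; rewrite /letter if_neg.
Qed.
End Travel.

Inductive monoid_eq : seq 'I_n -> seq 'I_n -> Prop :=
| monoid_eq_rel i j k : i != j -> M i j = Some k ->
    monoid_eq (altword i j k) (altword j i k)
| monoid_eq_cat u u' v v' :
    monoid_eq u u' -> monoid_eq v v' -> monoid_eq (u ++ v) (u' ++ v')
| monoid_eq_refl u : monoid_eq u u
| monoid_eq_sym u v : monoid_eq u v -> monoid_eq v u
| monoid_eq_trans u v w : monoid_eq u v -> monoid_eq v w -> monoid_eq u w.

Lemma monoid_eq_cons i u v : monoid_eq u v -> monoid_eq (i :: u) (i :: v).
Proof. exact: (monoid_eq_cat (monoid_eq_refl [:: i])). Qed.

Lemma size_altword (T : Type) (x y : T) k : size (altword x y k) = k.
Proof. by elim: k x y => //= k IH x y; rewrite IH. Qed.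

Lemma altwordS (T : Type) (x y : T) k :
  altword x y k.+1 = rcons (altword x y k) (if odd k then y else x).
Proof. by elim: k x y => //= k IH x y; rewrite if_neg; congr cons; exact: IH. Qed.

Lemma positive_altword (i j : 'I_n) k : positive (altword i j k) = alternating i j k.
Proof. by elim: k i j => //= k IH i j; rewrite -IH. Qed.

Lemma monoid_eq_size u v : monoid_eq u v -> size u = size v.
Proof.
elim=> {u v} [i j k _ _|u u' v v' _ uu _ vv| | |u v w _ -> _ -> //] //.
- by rewrite !size_altword.
- by rewrite !size_cat uu vv.
Qed.

Lemma positive_cat (u v : seq 'I_n) : positive (u ++ v) = positive u ++ positive v.
Proof. exact: map_cat. Qed.

Lemma monoid_eq_presented u v : monoid_eq u v ->
  presented_eq (artin_rel M) (positive u) (positive v).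
Proof.
elim=> {u v} [i j k ij Mk|u u' v v' _ uu _ vv|u|u v _ uv|u v w _ uv _ vw].
- by rewrite !positive_altword; apply/presented_eq_rel/ArtinRel.
- by rewrite !positive_cat; apply: presented_eq_cat.
- exact: presented_eq_refl.
- exact: presented_eq_sym.
- exact: presented_eq_trans uv vw.
Qed.

Lemma vanishes_presented_eq u v x :
  presented_eq (artin_rel M) (positive u) (positive v) ->
  nvanishes (unfold u) x -> nvanishes (unfold v) x.
Proof. by move=> uv du w; rewrite -(steps_presented_eq _ uv). Qed.

(** If the word starts with [j], then [vanishes_travel] produces the letters of
    the relation between [i] and [j] one by one behind it: each new simple root
    shows, by induction on the length, that the next letter of the alternating
    word can be brought to the front of the remaining word.  When the alternating
    word is complete, the relation replaces its first letter by [i]; for an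
    infinite label the word would be longer than [L]. *)
Lemma vanishes_divisor b i z : (size b < L)%N -> (z < width)%N ->
  nvanishes (unfold b) (nsimple (i, z)) -> exists c, monoid_eq b (i :: c).
Proof.
move: {2}(size b) (leqnn (size b)) => m; elim: m b i z => [|m IH] b i z.
  by rewrite leqn0 => /nilP -> _ _ /vanishes_nil.
case: b => [|j c] sb bL zw db; first by have := vanishes_nil db.
case: (eqVneq i j) => [->|ij]; first by exists c; apply: monoid_eq_refl.
have k2 := label_ge2 ij.
have [d dE] : exists d, monoid_eq (j :: c) (altword j i (label i j) ++ d).
  have : (0 < label i j <= label i j)%N by lia.
  move: {1 2 4}(label i j) => r; elim: r => // -[_ _|r IHr rk].
    by exists c; apply: monoid_eq_refl.
  have [|d dE] := IHr; first by lia.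
  have /(vanishes_travel ij zw) : (0 < r.+1 <= (label i j).-1)%N by lia.
  move=> /(_ d) [|z' zw' dd].
    exact: vanishes_presented_eq (monoid_eq_presented dE) db.
  have sd : (size d + r.+1 = size (j :: c))%N.
    by rewrite (monoid_eq_size dE) size_cat size_altword addnC.
  have [||d' dE'] := IH d _ z' _ _ zw' dd; [by move: sd sb bL => /=; lia..|].
  exists d'; apply: monoid_eq_trans dE _.
  rewrite [altword j i r.+2]altwordS cat_rcons.
  exact: monoid_eq_cat (monoid_eq_refl _) dE'.
move: dE; rewrite /label; case Mk : (M i j) => [k|] /= dE; last first.
  by have := monoid_eq_size dE; rewrite size_cat size_altword; move: bL => /=; lia.
exists (altword j i k.-1 ++ d); apply: monoid_eq_trans dE _.
rewrite -cat_cons; apply: monoid_eq_cat (monoid_eq_refl _).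
have -> : i :: altword j i k.-1 = altword i j k.
  by move: k2; rewrite /label Mk /=; case: (k).
by apply/monoid_eq_sym/monoid_eq_rel.
Qed.

Lemma vanishes_cons i b : nvanishes (unfold (i :: b)) (nsimple (i, 0%N)).
Proof.
rewrite /unfold /= /fiber; have := width_gt0; case: width => // w _ /=.
exact: vanishes_simple.
Qed.

Lemma positive_cancel i u v :
  presented_eq (artin_rel M) (positive (i :: u)) (positive (i :: v)) ->
  presented_eq (artin_rel M) (positive u) (positive v).
Proof.
have mulE w : (artin_gen M i * presented_class (artin_rel M) (positive w))%g
    = presented_class (artin_rel M) (positive (i :: w)) :> artin_group M.
  exact: presented_mul_class.
move=> /presented_classP uv; apply/presented_classP.
by apply: (@mulgI (artin_group M) (artin_gen M i)); rewrite !mulE.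
Qed.

(** Paris: the Artin monoid embeds in the Artin group. *)
Lemma presented_eq_monoid u v : (size u < L)%N -> (size v < L)%N ->
  presented_eq (artin_rel M) (positive u) (positive v) -> monoid_eq u v.
Proof.
elim: u v => [|i u IH] v uL vL uv.
  case: v uv vL => [|i v] uv vL; first exact: monoid_eq_refl.
  have := vanishes_presented_eq (presented_eq_sym uv) (@vanishes_cons i v).
  by move=> /vanishes_nil.
have [c vE] := vanishes_divisor vL width_gt0
  (vanishes_presented_eq uv (@vanishes_cons i u)).
apply: monoid_eq_trans (monoid_eq_sym vE); apply: monoid_eq_cons; apply: IH.
- by move: uL => /=; lia.
- by move: vL; rewrite (monoid_eq_size vE) /=; lia.
apply: (positive_cancel (i := i)).
exact: presented_eq_trans uv (monoid_eq_presented vE).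
Qed.
End Folding.

Local Close Scope ring_scope.

(** * Hurwitz moves on sequences *)

Section HurwitzSequences.
Local Open Scope group_scope.
Variable G : groupType.
Implicit Types (u v w : seq G) (x y h : G).

(** Hurwitz equivalence of sequences of any length, without the braid group:
    easier to use inside concatenations than the action on tuples. *)
Inductive hurwitz_seq : seq G -> seq G -> Prop :=
| hurwitz_seq_move u x y v :
    hurwitz_seq (u ++ x :: y :: v) (u ++ y :: x ^ y :: v)
| hurwitz_seq_refl u : hurwitz_seq u u
| hurwitz_seq_sym u v : hurwitz_seq u v -> hurwitz_seq v u
| hurwitz_seq_trans u v w :
    hurwitz_seq u v -> hurwitz_seq v w -> hurwitz_seq u w.

Lemma hurwitz_seq_cat p q u v :
  hurwitz_seq u v -> hurwitz_seq (p ++ u ++ q) (p ++ v ++ q).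
Proof.
elim=> {u v} [u x y v|u|u v _|u v w _ uv _ vw].
- rewrite -!catA !cat_cons !(catA p); exact: hurwitz_seq_move.
- exact: hurwitz_seq_refl.
- exact: hurwitz_seq_sym.
- exact: hurwitz_seq_trans uv vw.
Qed.

Lemma hurwitz_seq_cons x u v : hurwitz_seq u v -> hurwitz_seq (x :: u) (x :: v).
Proof. by move=> /(hurwitz_seq_cat [:: x] [::]); rewrite !cats0. Qed.

Lemma hurwitz_seq_size u v : hurwitz_seq u v -> size u = size v.
Proof.
elim=> {u v} // [u x y v|u v w _ -> _ ->] //; by rewrite !size_cat.
Qed.

Lemma hurwitz_seq_conj h u v : hurwitz_seq u v ->
  hurwitz_seq [seq x ^ h | x <- u] [seq x ^ h | x <- v].
Proof.
elim=> {u v} [u x y v|u|u v _|u v w _ uv _ vw].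
- rewrite !map_cat /= conjJg; exact: hurwitz_seq_move.
- exact: hurwitz_seq_refl.
- exact: hurwitz_seq_sym.
- exact: hurwitz_seq_trans uv vw.
Qed.

Lemma hurwitz_seq_to_front u x :
  hurwitz_seq (rcons u x) (x ^ (\prod_(y <- u) y)^-1 :: u).
Proof.
elim: u => [|y u IH] /=; first by rewrite big_nil invg1 conjg1; apply: hurwitz_seq_refl.
apply: hurwitz_seq_trans (hurwitz_seq_cons y IH) _.
rewrite big_cons invgM conjgM; set x' := x ^ _.
have := hurwitz_seq_move [::] (x' ^ y^-1) y u; rewrite /= conjgKV.
exact: hurwitz_seq_sym.
Qed.

Lemma hurwitz_seq_to_back y u :
  hurwitz_seq (y :: u) (rcons [seq x ^ y^-1 | x <- u] y).
Proof.
elim: u => [|x u IH] /=; first exact: hurwitz_seq_refl.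
apply: hurwitz_seq_trans (hurwitz_seq_cons _ IH).
have := hurwitz_seq_move [::] (x ^ y^-1) y u; rewrite /= conjgKV.
exact: hurwitz_seq_sym.
Qed.

Lemma val_hurwitz_move m (g : m.-tuple G) (i : 'I_m.-1) :
  exists u x y v, [/\ tval g = u ++ x :: y :: v
    & tval (hurwitz_move g i) = u ++ y :: x ^ y :: v].
Proof.
have im : (i.+1 < size g)%N by rewrite size_tuple; have := ltn_ord i; lia.
exists (take i g), (nth 1 g i), (nth 1 g i.+1), (drop i.+2 g).
have gE : tval g = take i g ++ nth 1 g i :: nth 1 g i.+1 :: drop i.+2 g.
  by rewrite -(drop_nth 1 im) -(drop_nth 1 (ltnW im)) cat_take_drop.
split=> //; apply: (@eq_from_nth _ 1).
  rewrite size_tuple size_cat /= size_take size_drop size_tuple.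
  by have := ltn_ord i; case: ifP; rewrite size_tuple in im; lia.
move=> j; rewrite size_tuple => jm.
rewrite (hurwitz_move_nth g i j) nth_cat size_take (ltn_trans (ltnSn i) im).
case: ltnP => ji.
  rewrite nth_take // !ifF //; lia.
case: (eqVneq j i) => [->|ni]; first by rewrite subnn.
case: (eqVneq j i.+1) => [->|ni1]; first by rewrite subSnn.
have [k ->] : exists k, j = (i + k.+2)%N by exists (j - i.+2)%N; lia.
by rewrite addKn /= nth_drop; congr nth; lia.
Qed.

Lemma hurwitz_equiv_refl m (a : m.-tuple G) : hurwitz_equiv a a.
Proof. by exists 1; have [-> _] := hurwitz_act_action G m. Qed.

Lemma hurwitz_equiv_trans m (a b c : m.-tuple G) :
  hurwitz_equiv a b -> hurwitz_equiv b c -> hurwitz_equiv a c.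
Proof.
move=> [s <-] [t <-]; exists (s * t).
by have [_ ->] := hurwitz_act_action G m.
Qed.

Lemma hurwitz_equiv_sym m (a b : m.-tuple G) :
  hurwitz_equiv a b -> hurwitz_equiv b a.
Proof.
move=> [s <-]; exists s^-1; have [H1 HM] := hurwitz_act_action G m.
by rewrite -HM mulgV H1.
Qed.

Lemma hurwitz_seq_equiv m (a b : m.-tuple G) :
  hurwitz_seq a b -> hurwitz_equiv a b.
Proof.
move: {1 3}(tval a) (erefl (tval a)) => u uE.
move: {1 3}(tval b) (erefl (tval b)) => v vE uv.
elim: uv m a b uE vE => {u v} [u x y v|u|u v _ IH|u v w uv IHuv _ IHvw] m a b aE bE.
- have ma : m = (size u + (size v).+2)%N.
    by rewrite -(size_tuple a) -aE size_cat.
  have im : (size u < m.-1)%N by lia.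
  exists (braid_sigma (Ordinal im)); rewrite hurwitz_act_sigma.
  apply: tuple_nth_ext => j; rewrite hurwitz_move_nth /= -aE -bE !nth_cat.
  rewrite ltnn subnn ltnNge leqnSn subSnn /=.
  case: (ltngtP j (size u)) => ju.
  + by rewrite (_ : (j == _) = false) //; lia.
  + case: (eqVneq j (size u).+1) => [->|ju']; first by rewrite subSnn.
    by have [k ->] : exists k, (j - size u)%N = k.+2 by exists (j - size u).-2; lia.
  + by rewrite ju subnn.
- suff -> : a = b by apply: hurwitz_equiv_refl.
  by apply: val_inj; rewrite /= -aE -bE.
- by apply: hurwitz_equiv_sym; apply: IH.
have wm : size v == m.
  by rewrite -(hurwitz_seq_size uv) aE size_tuple.
apply: hurwitz_equiv_trans (IHuv _ _ (Tuple wm) aE erefl) _.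
exact: IHvw.
Qed.

Lemma hurwitz_equiv_seq m (a b : m.-tuple G) :
  hurwitz_equiv a b -> hurwitz_seq a b.
Proof.
move=> [s <-]; rewrite /hurwitz_act; move: (repr _) => w {s b}.
elim: w a => [|[i e] w IH] a; first exact: hurwitz_seq_refl.
apply: hurwitz_seq_trans (IH _) => /=.
have mv (g : m.-tuple G) : hurwitz_seq g (hurwitz_move g i).
  have [u [x [y [v [-> ->]]]]] := val_hurwitz_move g i; exact: hurwitz_seq_move.
case: e; first exact: mv.
by apply: hurwitz_seq_sym; rewrite -{2}[a](hurwitz_move_invK a i).
Qed.

Lemma hurwitz_seq_prod u v : hurwitz_seq u v ->
  \prod_(x <- u) x = \prod_(x <- v) x.
Proof.
elim=> {u v} [u x y v||u v _ -> //|u v w _ -> _ -> //] //.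
rewrite !big_cat !big_cons; congr (_ * _).
change (x * (y * \prod_(z <- v) z) = y * (x ^ y * \prod_(z <- v) z)).
by rewrite (mulgA x) (mulgA y) -conjgC.
Qed.

Lemma hc_equivP m (a b : m.-tuple G) :
  hc_equiv a b <-> exists h, hurwitz_seq [seq x ^ h | x <- a] b.
Proof.
split=> [[[h s] ab]|[h /hurwitz_seq_equiv]].
  by exists h; apply: (@hurwitz_equiv_seq _ (conj_act a h)); exists s.
by move=> [s ab]; exists (h, s).
Qed.
End HurwitzSequences.

Section Words.
Local Open Scope group_scope.
Variables (n : nat) (M : coxeter_matrix n).
Implicit Types (u v w : seq 'I_n).

Definition gens w : seq (artin_group M) := [seq artin_gen M i | i <- w].

Definition class (w : letters 'I_n) : artin_group M :=
  presented_class (artin_rel M) w.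

Lemma classM s t : class (s ++ t) = class s * class t.
Proof. by apply/esym; apply: presented_mul_class. Qed.

Lemma class_nil : class [::] = 1.
Proof. by []. Qed.

Lemma class_cons l t : class (l :: t) = class [:: l] * class t.
Proof. exact: (classM [:: l]). Qed.

Lemma class_inv i : class [:: (i, false)] = (artin_gen M i)^-1.
Proof.
apply: (@mulgI _ (artin_gen M i)).
rewrite mulgV -[artin_gen M i]/(class [:: (i, true)]).
by rewrite -classM; apply/presented_classP/presented_eq_cancel.
Qed.

Lemma class_gen i : class [:: (i, true)] = artin_gen M i.
Proof. by []. Qed.

Lemma prod_gens w : \prod_(x <- gens w) x = class (positive w).
Proof.
elim: w => [|i w IH]; first by rewrite big_nil.
by rewrite big_cons IH [RHS]class_cons.
Qed.

Lemma generator_system_word m (a : m.-tuple (artin_group M)) :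
  generator_system a -> exists w, tval a = gens w.
Proof.
move=> ga; have : forall x, x \in tval a -> exists i, x = artin_gen M i.
  by move=> x /tnthP[j ->]; apply: ga.
elim: (tval a) => [_|x s IH xs]; first by exists [::].
have [i ->] := xs x (mem_head _ _).
have [|w ->] := IH; last by exists (i :: w).
by move=> y ys; apply: xs; rewrite inE ys orbT.
Qed.

(** Moved to the front, the last letter of an alternating word is conjugated into
    the first letter of the other alternating word. *)
Lemma hurwitz_altword (i j : 'I_n) k : i != j -> M i j = Some k ->
  hurwitz_seq (gens (altword i j k)) (gens (altword j i k)).
Proof.
move=> ij Mk; case: k Mk => [|k] Mk; first exact: hurwitz_seq_refl.
have -> : gens (altword i j k.+1)
    = rcons (gens (altword i j k)) (artin_gen M (if odd k then j else i)).
  by rewrite altwordS /gens map_rcons.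
have e : class (positive (altword i j k.+1)) = class (positive (altword j i k.+1)).
  by rewrite !positive_altword; apply/presented_classP/presented_eq_rel/ArtinRel.
rewrite -[gens (altword j i k.+1)]/(artin_gen M j :: gens (altword i j k)).
suff <- : artin_gen M (if odd k then j else i)
      ^ (\prod_(x <- gens (altword i j k)) x)^-1
    = artin_gen M j by exact: hurwitz_seq_to_front.
rewrite prod_gens conjgE invgK; apply: (@mulIg _ (class (positive (altword i j k)))).
rewrite !mulgA mulgVK -class_gen -class_cons.
by move: e; rewrite altwordS -cats1 positive_cat classM.
Qed.

Lemma monoid_eq_hurwitz u v : monoid_eq M u v -> hurwitz_seq (gens u) (gens v).
Proof.
elim=> {u v} [i j k|u u' v v' _ uu _ vv|u|u v _|u v w _ uv _ vw].
- exact: hurwitz_altword.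
- rewrite /gens !map_cat; apply: (@hurwitz_seq_trans _ _ (gens u' ++ gens v)).
    exact: (hurwitz_seq_cat [::]).
  by have := hurwitz_seq_cat (gens u') [::] vv; rewrite !cats0.
- exact: hurwitz_seq_refl.
- exact: hurwitz_seq_sym.
- exact: hurwitz_seq_trans uv vw.
Qed.

Lemma class_eq_hurwitz u v : class (positive u) = class (positive v) ->
  hurwitz_seq (gens u) (gens v).
Proof.
move=> /presented_classP uv; apply: monoid_eq_hurwitz.
apply: (@presented_eq_monoid _ M (size u + size v).+2) => //; rewrite ltnS.
  exact/leqW/leq_addr.
exact/leqW/leq_addl.
Qed.
End Words.

(** * Right-angled groups: normal forms and conjugacy *)

Section RightAngled.
Local Open Scope group_scope.
Variables (n : nat) (M : coxeter_matrix n).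
Hypothesis ra : right_angled M.
Implicit Types (x y l : 'I_n * bool) (u v w : letters 'I_n).

(** Two letters of the same generator do not count as commuting, so that the
    order in which they occur is never forgotten. *)
Definition commuting (i j : 'I_n) : bool := (i != j) && (M i j == Some 2).

Lemma commuting_sym i j : commuting i j = commuting j i.
Proof. by rewrite /commuting eq_sym cox_sym. Qed.

Lemma commuting_neq i j : commuting i j -> i != j.
Proof. by case/andP. Qed.

Lemma commuting_irr i : commuting i i = false.
Proof. by rewrite /commuting eqxx. Qed.

Definition letter_inv (x : 'I_n * bool) : 'I_n * bool := (x.1, ~~ x.2).

Lemma letter_invK : involutive letter_inv.
Proof. by case=> i b; rewrite /letter_inv /= negbK. Qed.

Definition proj (i j : 'I_n) (w : letters 'I_n) : letters 'I_n :=
  [seq l <- w | (l.1 == i) || (l.1 == j)].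

(** Equality up to commutations of neighbouring commuting letters, in terms of
    the projections to pairs of generators that do not commute.  This form makes
    congruence and cancellation immediate. *)
Definition trace_eq u v := forall i j, ~~ commuting i j -> proj i j u = proj i j v.

Lemma trace_eq_refl u : trace_eq u u. Proof. by []. Qed.

Lemma trace_eq_sym u v : trace_eq u v -> trace_eq v u.
Proof. by move=> uv i j ij; rewrite uv. Qed.

Lemma trace_eq_trans u v w : trace_eq u v -> trace_eq v w -> trace_eq u w.
Proof. by move=> uv vw i j ij; rewrite uv ?vw. Qed.

Lemma trace_eq_cons x u v : trace_eq (x :: u) (x :: v) <-> trace_eq u v.
Proof.
by split=> uv i j ij; have := uv i j ij; rewrite /proj /=;
  case: ifP => // _; [case|move=> ->].
Qed.

Lemma trace_eq_swap x y w : commuting x.1 y.1 ->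
  trace_eq (x :: y :: w) (y :: x :: w).
Proof.
move=> xy i j ij; rewrite /proj /=.
case: ifP => xi; case: ifP => yi //; move: ij xy.
by case/orP: xi => /eqP ->; case/orP: yi => /eqP ->; rewrite ?commuting_irr //
  1?commuting_sym => /negPf ->.
Qed.

(** Brings the letter [x] to the front of [w] by commutations and removes it. *)
Fixpoint strip x w : option (letters 'I_n) :=
  if w is y :: w' then
    if y == x then Some w'
    else if commuting y.1 x.1 then omap (cons y) (strip x w') else None
  else None.

Lemma strip_trace x w w' : strip x w = Some w' -> trace_eq w (x :: w').
Proof.
elim: w w' => //= y w IH w'; case: eqP => [-> [->] //|_].
case: ifP => // yx; case E : (strip x w) => [s|] //= [<-].
apply: trace_eq_trans (trace_eq_swap _ yx).
exact/trace_eq_cons/IH.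
Qed.

(** The letters that keep [x] from being brought to the front are visible in the
    projection to the generator of [x] and their own. *)
Lemma strip_head x w :
    (forall j, ~~ commuting x.1 j -> exists r, proj x.1 j w = x :: r) ->
  strip x w <> None.
Proof.
elim: w => [|y w IH] /= h.
  by have [|r] := h x.1; rewrite ?commuting_irr.
case: eqP => // yx.
have [yc|nyc] := boolP (commuting y.1 x.1); last first.
  have [|r] := h y.1; first by rewrite commuting_sym.
  by rewrite /proj /= eqxx orbT => -[].
case E : (strip x w) => [//|] _; apply: IH E => j jx.
have [r] := h j jx; rewrite /proj /= (negPf (commuting_neq yc)) /=.
case: eqP => [yj|_]; last by exists r.
by rewrite commuting_sym yj (negPf jx) in yc.
Qed.

Lemma trace_strip x u w : trace_eq (x :: u) w ->
  exists2 w', strip x w = Some w' & trace_eq u w'.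
Proof.
move=> uw; case E : (strip x w) => [w'|]; last first.
  case/strip_head: E => j jx; rewrite -uw // /proj /= eqxx.
  by exists (proj x.1 j u).
exists w' => //; apply/(trace_eq_cons x); exact: trace_eq_trans uw (strip_trace E).
Qed.

Lemma strip_congr x u v u' : trace_eq u v -> strip x u = Some u' ->
  exists2 v', strip x v = Some v' & trace_eq u' v'.
Proof.
move=> uv /strip_trace uu; apply: trace_strip.
exact: trace_eq_trans (trace_eq_sym uu) uv.
Qed.

Lemma strip_congr_none x u v : trace_eq u v -> strip x u = None -> strip x v = None.
Proof.
move=> uv su; case E : (strip x v) => [v'|] //.
by have [u'] := strip_congr (trace_eq_sym uv) E; rewrite su.
Qed.

Lemma strip_cons_far x y w : commuting y.1 x.1 ->
  strip x (y :: w) = omap (cons y) (strip x w).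
Proof.
move=> yx /=; rewrite yx; case: eqP => // e.
by rewrite e commuting_irr in yx.
Qed.

Fixpoint reduced w : bool :=
  if w is x :: w' then reduced w' && (strip (letter_inv x) w' == None) else true.

Lemma reduced_cons x w : reduced (x :: w) <->
  reduced w /\ strip (letter_inv x) w = None.
Proof. by rewrite /=; split=> [/andP[? /eqP]|[-> ->]]. Qed.

Lemma strip_far_trans x y w a b : commuting x.1 y.1 ->
  strip x w = Some a -> strip y w = Some b ->
  exists2 c, strip y a = Some c & trace_eq b (x :: c).
Proof.
move=> xy wa wb; have yx : commuting y.1 x.1 by rewrite commuting_sym.
have ab := trace_eq_trans (trace_eq_sym (strip_trace wb)) (strip_trace wa).
have [a' ] := trace_strip ab; rewrite strip_cons_far //.
by case E : (strip y a) => [c|] //= [<-] bc; exists c.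
Qed.

Lemma strip_far_none x y w a : commuting x.1 y.1 ->
  strip x w = Some a -> strip y w = None -> strip y a = None.
Proof.
move=> xy wa wn; case E : (strip y a) => [c|] //.
have yx : commuting y.1 x.1 by rewrite commuting_sym.
have : trace_eq (y :: x :: c) w.
  apply: trace_eq_trans (trace_eq_swap _ yx) _.
  apply: trace_eq_sym; apply: trace_eq_trans (strip_trace wa) _.
  exact/trace_eq_cons/strip_trace.
by move=> /trace_strip[w']; rewrite wn.
Qed.

Lemma reduced_strip x w w' : reduced w -> strip x w = Some w' ->
  reduced w' /\ strip (letter_inv x) w' = None.
Proof.
elim: w w' => // y w IH w' /reduced_cons[rw yw] /=.
case: eqP => [<- [<-] //|_]; case: ifP => // yx.
case E : (strip x w) => [s|] //= [<-].
have [rs xs] := IH _ rw E; split.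
  apply/reduced_cons; split=> //.
  by apply: strip_far_none E yw; rewrite commuting_sym.
by rewrite -[LHS]/(strip (letter_inv x) (y :: s)) strip_cons_far // xs.
Qed.

Lemma reduced_unstrip x w w' : strip x w = Some w' -> reduced w' ->
  strip (letter_inv x) w' = None -> reduced w.
Proof.
elim: w w' => //= y w IH w'.
case: eqP => [<- [<-] -> -> //|_]; case: ifP => // yx.
case E : (strip x w) => [s|] //= [<-] /andP[rs /eqP ys].
rewrite -[X in X -> _]/(strip (letter_inv x) (y :: s) = None) strip_cons_far //.
case xs : (strip (letter_inv x) s) => [//|] _; rewrite (IH s) //=.
case F : (strip (letter_inv y) w) => [t|] //.
have [|c] := strip_far_trans (x := x) (y := letter_inv y) _ E F.
  by rewrite commuting_sym.
by rewrite ys.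
Qed.

Lemma reduced_trace u v : trace_eq u v -> reduced u -> reduced v.
Proof.
elim: u v => [|x u IH] v uv; first last.
  move=> /reduced_cons[ru xu].
  have [v' vv uv'] := trace_strip uv.
  apply: reduced_unstrip vv (IH _ uv' ru) _.
  exact: strip_congr_none uv' xu.
case: v uv => // y v /(_ y.1 y.1); rewrite commuting_irr /proj /= eqxx.
by move=> /(_ isT).
Qed.

(** Left multiplication by [x] on reduced words.  That it defines an action of
    the group up to commutations, [push_word_presented], is van der Waerden's
    argument for normal forms. *)
Definition push x w := if strip (letter_inv x) w is Some w' then w' else x :: w.

Definition push_word u w := foldr push w u.

Lemma reduced_push x w : reduced w -> reduced (push x w).
Proof.
rewrite /push => rw; case E : (strip _ w) => [w'|]; last exact/reduced_cons.
by have [] := reduced_strip rw E.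
Qed.

Lemma reduced_push_word u w : reduced w -> reduced (push_word u w).
Proof. by move=> rw; elim: u => //= x u; apply: reduced_push. Qed.

Lemma push_congr x u v : trace_eq u v -> trace_eq (push x u) (push x v).
Proof.
rewrite /push => uv; case E : (strip _ u) => [u'|].
  by have [v' ->] := strip_congr uv E.
by rewrite (strip_congr_none uv E); apply/trace_eq_cons.
Qed.

Lemma push_word_congr w u v : trace_eq u v ->
  trace_eq (push_word w u) (push_word w v).
Proof. by move=> uv; elim: w => //= x w; apply: push_congr. Qed.

Lemma pushK x w : reduced w -> trace_eq (push (letter_inv x) (push x w)) w.
Proof.
move=> rw; rewrite {2}/push; case E : (strip _ w) => [w'|]; last first.
  by rewrite /push /= letter_invK eqxx.
have [_ nw'] := reduced_strip rw E.
by rewrite /push nw'; apply/trace_eq_sym/strip_trace.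
Qed.

Lemma push_comm x y w : commuting x.1 y.1 ->
  trace_eq (push x (push y w)) (push y (push x w)).
Proof.
have far (a b : 'I_n * bool) z : commuting a.1 b.1 -> strip (letter_inv a) z = None ->
    trace_eq (push a (push b z)) (push b (push a z)).
  move=> ab az; have ba : commuting b.1 a.1 by rewrite commuting_sym.
  rewrite {4}/push az; rewrite {2 3}/push (@strip_cons_far (letter_inv b) a _ ab).
  case E : (strip (letter_inv b) z) => [c|] /=.
    by rewrite /push (@strip_far_none (letter_inv b) (letter_inv a) _ _ ba E az).
  by rewrite /push (@strip_cons_far (letter_inv a) b _ ba) az; apply: trace_eq_swap.
move=> xy; have yx : commuting y.1 x.1 by rewrite commuting_sym.
case E : (strip (letter_inv x) w) => [a|]; last exact: far.
case F : (strip (letter_inv y) w) => [b|]; last exact/trace_eq_sym/far.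
have [c yc bc] := strip_far_trans (x := letter_inv x) (y := letter_inv y) xy E F.
rewrite {2 4}/push E F {2}/push yc.
apply: trace_eq_trans (push_congr x bc) _.
by rewrite /push /= eqxx.
Qed.

Lemma artin_rel_commuting u v : artin_rel M u v ->
  exists i j, [/\ commuting i j, u = [:: (i, true); (j, true)]
    & v = [:: (j, true); (i, true)]].
Proof.
case=> i j k ij Mk; exists i, j.
have k2 : k = 2 by case: (ra ij); rewrite Mk => // -[].
by split; rewrite ?k2 // /commuting ij Mk k2.
Qed.

Lemma push_word_presented u v w : presented_eq (artin_rel M) u v -> reduced w ->
  trace_eq (push_word u w) (push_word v w).
Proof.
move=> uv; elim: uv w => {u v}
  [u v /artin_rel_commuting[i [j [ij -> ->]]]|x b|u u' v v' _ IHu _ IHv|u|u v _ IH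
  |u v t _ IHu _ IHv] w rw.
- exact: push_comm.
- have := pushK (x, ~~ b) rw; by rewrite /letter_inv /= negbK.
- rewrite /push_word !foldr_cat -!/(push_word _ _).
  apply: trace_eq_trans (IHu _ _) _; first exact: reduced_push_word.
  exact/push_word_congr/IHv.
- exact: trace_eq_refl.
- exact/trace_eq_sym/IH.
- exact: trace_eq_trans (IHu _ rw) (IHv _ rw).
Qed.

Lemma push_word_reduced u : reduced u -> push_word u [::] = u.
Proof.
by elim: u => //= x u IH /andP[/IH -> /eqP]; rewrite /push => ->.
Qed.

(** Let the group act on the empty word: a reduced word sends it to itself. *)
Lemma reduced_class_trace u v : reduced u -> reduced v ->
  class M u = class M v -> trace_eq u v.
Proof.
move=> ru rv /presented_classP uv.
by have := push_word_presented uv (w := [::]) isT; rewrite !push_word_reduced.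
Qed.

Lemma class_commute x y : commuting x.1 y.1 ->
  commute (class M [:: x]) (class M [:: y]).
Proof.
case: x y => [i b] [j c] /= ij.
have gij : commute (artin_gen M i) (artin_gen M j).
  case/andP: ij => ij /eqP Mij.
  rewrite /commute -!class_gen -!classM /=; apply/presented_classP.
  exact/presented_eq_rel/(ArtinRel ij Mij).
have gV k d : class M [:: (k, d)] = if d then artin_gen M k else (artin_gen M k)^-1.
  by case: d; rewrite ?class_inv.
rewrite !gV; case: b c => [] [] //.
- exact: commuteV.
- exact/commute_sym/commuteV/commute_sym.
- exact/commuteV/commute_sym/commuteV/commute_sym.
Qed.

Definition far x w := all (fun y => commuting y.1 x.1) w.

Lemma class_far x w : far x w -> commute (class M [:: x]) (class M w).
Proof.
elim: w => [_|y w IH /= /andP[yx xw]]; first by rewrite class_nil; apply: commute1.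
rewrite (class_cons M y w); apply: commuteM (IH xw).
by apply: class_commute; rewrite commuting_sym.
Qed.

Lemma trace_eq_far x w : far x w -> trace_eq (x :: w) (rcons w x).
Proof.
elim: w => //= y w IH /andP[yx xw].
apply: trace_eq_trans (trace_eq_swap _ _) _; first by rewrite commuting_sym.
exact/trace_eq_cons/IH.
Qed.

Lemma strip_class x w w' : strip x w = Some w' ->
  class M w = class M [:: x] * class M w'.
Proof.
elim: w w' => //= y w IH w'; case: eqP => [-> [<-]|_]; first exact: class_cons.
case: ifP => // yx; case E : (strip x w) => [s|] //= [<-].
rewrite (class_cons M y w) (IH _ E) (class_cons M y s) !mulgA; congr (_ * _).
exact: class_commute.
Qed.

Lemma strip_cat x a b t : strip x (a ++ b) = Some t ->
  (exists a', strip x a = Some a')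
  \/ far x a /\ exists2 b', strip x b = Some b' & t = a ++ b'.
Proof.
elim: a t => [|y a IH] t /=; first by right; split=> //; exists t.
case: eqP => [_ _|_]; first by left; exists a.
case: ifP => //= yx; case E : (strip x (a ++ b)) => [s|] //= [<-].
case: (IH _ E) => [[a' ->]|[xa [b' bb ->]]]; first by left; exists (y :: a').
by right; split=> //; exists b'.
Qed.

Lemma strip_positive x (w : seq 'I_n) t : strip x (positive w) = Some t ->
  x.2 /\ exists w' : seq 'I_n, t = positive w'.
Proof.
elim: w t => //= i w IH t; case: eqP => [<- [<-]|_]; first by split=> //; exists w.
case: ifP => // ix; case E : (strip x _) => [s|] //= [<-].
by have [x2 [w' ->]] := IH _ E; split=> //; exists (i :: w').
Qed.

(** No two letters of a positive word cancel, so a cancellation in the product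
    involves one letter of [u] and one letter of [g]. *)
Lemma reduced_left_or (u : seq 'I_n) g : reduced g ->
  reduced (positive u ++ g) \/
  exists (u' : seq 'I_n) s g',
  [/\ class M (positive u) = class M (positive (rcons u' s)),
    size u = (size u').+1 & strip (s, false) g = Some g'].
Proof.
move=> rg; elim: u => [|i u [IH|[u' [s [g' [cu su sg]]]]]]; first by left.
  case E : (strip (i, false) (positive u ++ g)) => [t|]; last first.
    by left; apply/reduced_cons.
  right; case: (strip_cat E) => [[a' /strip_positive[] //]|[fu [g' gg' _]]].
  exists u, i, g'; split=> //.
  rewrite -cats1 positive_cat classM [LHS]class_cons.
  by apply: (class_far (x := (i, true))); exact: fu.
right; exists (i :: u'), s, g'; split=> //=; last by rewrite su.
by rewrite [LHS]class_cons cu -class_cons.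
Qed.

Lemma reduced_right_or (v : seq 'I_n) g : reduced g ->
  reduced (g ++ positive v) \/
  exists (v' : seq 'I_n) s g',
  [/\ class M (positive v) = class M (positive (s :: v')),
    size g = (size g').+1 & trace_eq g (rcons g' (s, false))].
Proof.
elim: g => [_|x g IH /reduced_cons[rg xg]].
  left; elim: v => // i v IH; apply/reduced_cons; split=> //.
  by case E : (strip _ _) => [t|] //; have [] := strip_positive E.
case: (IH rg) => [rgv|[v' [s [g' [cv sg tg]]]]]; last first.
  right; exists v', s, (x :: g'); split=> //=; first by rewrite sg.
  exact/trace_eq_cons.
case E : (strip (letter_inv x) (g ++ positive v)) => [t|]; last first.
  by left; apply/reduced_cons.
right; case: (strip_cat E) => [[a']|[fg [t' vt' _]]]; first by rewrite xg.
have [] := strip_positive vt'; case: x E fg vt' xg => i [] //= E fg vt' xg _ [v' t'E].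
exists v', i, g; split=> //; last exact: trace_eq_far.
by rewrite (strip_class vt') t'E [RHS]class_cons.
Qed.

Definition hc_words (u v : seq 'I_n) :=
  exists h : artin_group M, hurwitz_seq [seq z ^ h | z <- gens M u] (gens M v).

Lemma hc_words_trans (u v w : seq 'I_n) : hc_words u v -> hc_words v w -> hc_words u w.
Proof.
move=> [h uv] [k vw]; exists (h * k); apply: hurwitz_seq_trans vw.
have -> : [seq z ^ (h * k) | z <- gens M u]
    = [seq z ^ k | z <- [seq z ^ h | z <- gens M u]].
  by rewrite -[RHS]map_comp; apply: eq_map => z; rewrite /= conjgM.
exact: hurwitz_seq_conj.
Qed.

Lemma hc_words_class (u v : seq 'I_n) :
  class M (positive u) = class M (positive v) -> hc_words u v.
Proof.
move=> /class_eq_hurwitz uv; exists 1; rewrite (eq_map (@conjg1 _)) map_id.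
exact: uv.
Qed.

(** Conjugation by [s] is undone on all entries but [s] when [s] is moved to the
    back. *)
Lemma hc_words_rotate s (w : seq 'I_n) : hc_words (s :: w) (rcons w s).
Proof.
exists (artin_gen M s); rewrite /gens map_rcons /= {1}/conjg mulKg.
apply: hurwitz_seq_trans (hurwitz_seq_to_back _ _) _.
rewrite (mapK (conjgK (artin_gen M s))); exact: hurwitz_seq_refl.
Qed.

Lemma hc_words_rotate_sym s (w : seq 'I_n) : hc_words (rcons w s) (s :: w).
Proof.
exists (artin_gen M s)^-1; rewrite /gens !map_rcons /=.
rewrite (_ : artin_gen M s ^ (artin_gen M s)^-1 = artin_gen M s).
  exact/hurwitz_seq_sym/hurwitz_seq_to_back.
by rewrite conjgE invgK mulgA mulgK.
Qed.

Lemma size_strip x (w w' : letters 'I_n) : strip x w = Some w' -> size w = (size w').+1.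
Proof.
elim: w w' => //= y w IH w'; case: eqP => [_ [<-] //|_]; case: ifP => // _.
by case E : (strip x w) => [s|] //= [<-]; rewrite (IH _ E).
Qed.

Lemma reduced_rcons g x : reduced (rcons g x) -> reduced g.
Proof.
elim: g => //= y g IH /andP[/IH -> /eqP] /=.
case E : (strip (letter_inv y) g) => [t|] //.
suff : strip (letter_inv y) (rcons g x) = Some (rcons t x) by move=> ->.
elim: g t E {IH} => //= z g IH t; case: eqP => [_ [<-] //|_]; case: ifP => // _.
by case E : (strip _ g) => [t'|] //= [<-]; rewrite (IH _ E).
Qed.

Lemma class_rcons g x : class M (rcons g x) = class M g * class M [:: x].
Proof. by rewrite -cats1 classM. Qed.

Lemma positive_rcons (w : seq 'I_n) s :
  positive (rcons w s) = rcons (positive w) (s, true).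
Proof. exact: map_rcons. Qed.

Lemma trace_class (u v : letters 'I_n) : trace_eq u v -> class M u = class M v.
Proof.
elim: u v => [|x u IH] v uv; last first.
  have [v' vv' uv'] := trace_strip uv.
  by rewrite class_cons (strip_class vv') (IH _ uv').
case: v uv => // y v /(_ y.1 y.1); rewrite commuting_irr /proj /= eqxx.
by move=> /(_ isT).
Qed.

(** Induction on the length of [g], which a rotation of [u] or [v], or the
    removal of a letter that commutes with [u], shortens by one. *)
Lemma conjugate_hc_words g (u v : seq 'I_n) : reduced g ->
  class M (positive u) * class M g = class M g * class M (positive v) ->
  hc_words u v.
Proof.
move: {2}(size g) (leqnn (size g)) => m.
elim: m g u v => [|m IH] g u v; first rewrite leqn0 => /nilP -> _.
  by rewrite mulg1 mul1g; apply: hc_words_class.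
move=> gm rg ug.
case: (reduced_left_or u rg) => [rl|[u' [s [g' [cu su sg]]]]]; last first.
  (* The last letter [s] of [u] cancels the first letter of [g]. *)
  have [rg' _] := reduced_strip rg sg.
  apply: hc_words_trans (hc_words_class cu) _.
  apply: hc_words_trans (hc_words_rotate_sym _ _) _.
  apply: (IH g') => //.
    by rewrite -ltnS (leq_trans _ gm) // (size_strip sg).
  apply: (@mulgI _ (class M [:: (s, false)])).
  rewrite !mulgA -(strip_class sg) -ug cu positive_rcons class_rcons.
  rewrite (strip_class sg) class_inv class_gen [positive _]/= class_cons class_gen.
  by rewrite !mulgA mulgK mulVg mul1g.
case: (reduced_right_or v rg) => [rr|[v' [s [g' [cv sg tg]]]]]; last first.
  (* The last letter of [g] cancels the first letter [s] of [v]. *)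
  have rg' := reduced_rcons (reduced_trace tg rg).
  apply: (@hc_words_trans _ (rcons v' s)); last first.
    apply: hc_words_trans (hc_words_rotate_sym _ _) _.
    exact/hc_words_class/esym.
  apply: (IH g') => //; first by rewrite -ltnS -sg.
  have gE : class M g = class M g' * (artin_gen M s)^-1.
    by rewrite (trace_class tg) class_rcons class_inv.
  have vE : class M (positive v) = artin_gen M s * class M (positive v').
    by rewrite cv [LHS]class_cons.
  rewrite positive_rcons class_rcons class_gen.
  apply: (@mulIg _ (artin_gen M s)^-1).
  by rewrite -mulgA -gE ug gE vE !mulgA mulgVK mulgK.
(* No cancellation: the first letter [x] of [g] is also a first letter of [u g]. *)
have tr : trace_eq (positive u ++ g) (g ++ positive v).
  by apply: reduced_class_trace; rewrite ?classM.
case: g gm rg ug {rl rr} tr => [|x h] gm rg ug tr.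
  by apply: hc_words_class; move: ug; rewrite mulg1 mul1g.
have [rh _] := reduced_cons x h; have {rh}[rh _] := rh rg.
have [t /strip_cat st _] := trace_strip (trace_eq_sym tr).
case: st => [[t' ut']|[fu _]]; last first.
  apply: (IH h) => //; apply: (@mulgI _ (class M [:: x])).
  rewrite mulgA (class_far fu) -mulgA -(class_cons M x h) ug.
  by rewrite (class_cons M x h) mulgA.
have [x2 [u' t'E]] := strip_positive ut'.
case: x x2 gm rg ug tr ut' => [i b] /= -> {b} gm _ ug _ ut'.
have uE : class M (positive u) = class M (positive (i :: u')).
  by rewrite (strip_class ut') t'E [RHS]class_cons.
apply: hc_words_trans (hc_words_class uE) _.
apply: hc_words_trans (hc_words_rotate _ _) _.
apply: (IH h) => //; apply: (@mulgI _ (artin_gen M i)).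
move: ug; rewrite uE (class_cons M _ h) [X in X * _ = _](class_cons M _ (positive u')).
by rewrite positive_rcons class_rcons class_gen -!mulgA.
Qed.

Lemma class_push x (w : letters 'I_n) : class M (push x w) = class M [:: x] * class M w.
Proof.
rewrite /push; case E : (strip _ w) => [w'|]; last exact: class_cons.
have xV : class M [:: x] * class M [:: letter_inv x] = 1.
  rewrite -classM; apply/presented_classP.
  by case: x {E} => i b; apply: presented_eq_cancel.
by rewrite (strip_class E) mulgA xV mul1g.
Qed.

Lemma reduced_class (h : artin_group M) : exists2 g, reduced g & class M g = h.
Proof.
have [w <-] : exists w, class M w = h by exists (repr h); apply: presented_reprK.
exists (push_word w [::]); first exact: reduced_push_word.
elim: w => //= x w IH; by rewrite class_push IH -class_cons.
Qed.
End RightAngled.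

Theorem corollary1 (n : nat) (M : coxeter_matrix n) (m : nat)
    (a a' : m.-tuple (artin_group M))
    (ha : generator_system a) (ha' : generator_system a') :
  (hurwitz_equiv a a' <-> coxeter_element a = coxeter_element a')
  /\
  (right_angled M ->
     (hc_equiv a a' <-> conjugate (coxeter_element a) (coxeter_element a'))).
Proof.
have [u aE] := generator_system_word ha.
have [v aE'] := generator_system_word ha'.
have C_class : coxeter_element a = class M (positive u).
  by rewrite /coxeter_element aE prod_gens.
have C_class' : coxeter_element a' = class M (positive v).
  by rewrite /coxeter_element aE' prod_gens.
split; first split=> [/hurwitz_equiv_seq/hurwitz_seq_prod //|].
  rewrite C_class C_class' => /class_eq_hurwitz; rewrite -aE -aE'.
  exact: hurwitz_seq_equiv.
move=> ra; split=> [/hc_equivP[h /hurwitz_seq_prod]|[h]].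
  rewrite big_map => e; exists h; rewrite /coxeter_element conjg_prod.
  exact: e.
rewrite C_class C_class' => uv; apply/hc_equivP; rewrite aE aE'.
have [g rg gh] := reduced_class h.
by apply: (conjugate_hc_words ra rg); rewrite gh -uv -conjgC.
Qed.
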